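(* Let $K\subseteq\mathbb{R}^n$ be a bounded star-shaped set with diameter $d=\sup_{x,y\in K}\|x-y\|$, let $\sigma>0$, and let $\varepsilon\in(0,\tfrac{1}{32})$. For a constant $c>0$ define $$\delta^*=\sup\Big\{\delta\ge 0:\ N\frac{\delta^2}{\sigma^2}\le \log M^{\mathrm{loc}}(\delta,c)\Big\}.$$ Then, for $c$ a sufficiently large absolute constant and under the assumption $N\gtrsim \sup_{\delta>0}\log M^{\mathrm{loc}}(\delta,c)$ (i.e. $N\ge A\sup_{\delta>0}\log M^{\mathrm{loc}}(\delta,c)$ for a suitable absolute constant $A$), the minimax risk satisfies $$\mathfrak{M}\asymp \max\big(\delta^{*2},\ \varepsilon\sigma^2\big)\wedge d^2 .$$
   Context: Model: fix integers $n,N\ge 1$, $\sigma>0$ and a contamination level $\varepsilon$. The unknown mean $\mu$ lies in a known set $K\subseteq\mathbb{R}^n$. The uncorrupted sample is $\tilde X_i=\mu+\xi_i$, $i=1,\dots,N$, where the $\xi_i$ are i.i.d. copies of a random vector $\xi$ whose distribution belongs to $\Xi_{\sigma^2}$, the family of all distributions on $\mathbb{R}^n$ with mean zero and covariance matrix $\Sigma\preceq\sigma^2 I$ (so only second moments are assumed). An adversary $\mathcal{C}$, which may inspect the entire uncorrupted sample and knows the model and the estimator, replaces at most a fraction $\varepsilon$ of the $N$ points by arbitrary points; the statistician observes $X=\mathcal{C}(\tilde X)$. The minimax risk is $$\mathfrak{M}=\inf_{\hat\mu}\sup_{\mu\in K}\sup_{\xi\in\Xi_{\sigma^2}}\sup_{\mathcal{C}}\mathbb{E}_\mu\big\|\hat\mu(\mathcal{C}(\tilde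 X))-\mu\big\|^2,$$ the infimum being over all estimators (functions of the observed data), $\|\cdot\|$ the Euclidean norm. Star-shaped: $K$ is star-shaped if there is $k^*\in K$ with $(1-t)k^*+tk\in K$ for all $k\in K$, $t\in[0,1]$. Local metric entropy: for $A\subseteq\mathbb{R}^n$, the $\eta$-packing number $M(\eta,A)$ is the maximal cardinality of a set $\{\nu_1,\dots,\nu_M\}\subset A$ with $\|\nu_i-\nu_j\|>\eta$ for $i\ne j$. For $c>0$, $M^{\mathrm{loc}}(\eta,c)=M^{\mathrm{loc}}_K(\eta,c):=\sup_{\nu\in K}M\big(\eta/c,\ B(\nu,\eta)\cap K\big)$, where $B(\nu,\eta)$ is the closed Euclidean ball; $\log M^{\mathrm{loc}}(\eta,c)$ is the local metric entropy. Notation: $a\wedge b=\min(a,b)$; $\asymp$ and $\gtrsim$ hold up to multiplicative constants not depending on $n,N,\sigma,\varepsilon,K$. *)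

(* Defs.v *)
From HB Require Import structures.
From mathcomp Require Import all_boot all_order all_algebra.
From mathcomp Require Import all_classical all_reals all_analysis.

Set Implicit Arguments.
Unset Strict Implicit.
Unset Printing Implicit Defensive.

Import Order.TTheory GRing.Theory Num.Theory.
Local Open Scope classical_set_scope.
Local Open Scope ring_scope.

(* Points of R^n are n-tuples of reals, so that
   R^n and (R^n)^N carry the library's product (= Borel) sigma-algebra. *)

Section Defs.
Context {R : realType}.

Definition vadd n (x y : n.-tuple R) : n.-tuple R :=
  [tuple tnth x i + tnth y i | i < n].
Definition vsub n (x y : n.-tuple R) : n.-tuple R :=
  [tuple tnth x i - tnth y i | i < n].
Definition vscale n (t : R) (x : n.-tuple R) : n.-tuple R :=
  [tuple t * tnth x i | i < n].

Definition enorm n (x : n.-tuple R) : R := Num.sqrt (\sum_(i < n) tnth x i ^+ 2).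
Definition edist n (x y : n.-tuple R) : R := enorm (vsub x y).

Definition cball n (nu : n.-tuple R) (eta : R) : set (n.-tuple R) :=
  [set x | edist x nu <= eta].

Definition bounded_euclid n (K : set (n.-tuple R)) : Prop :=
  exists r : R, forall x, K x -> enorm x <= r.

Definition star_shaped n (K : set (n.-tuple R)) : Prop :=
  exists kstar, K kstar /\
    forall k, K k -> forall t : R, 0 <= t <= 1 ->
      K (vadd (vscale (1 - t) kstar) (vscale t k)).

Definition diameter n (K : set (n.-tuple R)) : \bar R :=
  ereal_sup [set (edist x y)%:E | x in K & y in K].

Definition packing_number n (eta : R) (A : set (n.-tuple R)) : \bar R :=
  ereal_sup [set (size s)%:R%:E | s in
    [set s : seq (n.-tuple R) | (forall x, x \in s -> A x) /\
       pairwise (fun x y => eta < edist x y) s]].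

Definition local_packing n (K : set (n.-tuple R)) (eta c : R) : \bar R :=
  ereal_sup [set packing_number (eta / c) (cball nu eta `&` K) | nu in K].

Definition elog (x : \bar R) : \bar R :=
  match x with
  | r%:E => (ln r)%:E
  | +oo%E => +oo%E
  | -oo%E => -oo%E
  end.

Definition delta_star n (K : set (n.-tuple R)) (N : nat) (sigma c : R) : \bar R :=
  ereal_sup [set delta%:E | delta in
    [set delta : R | 0 <= delta /\
      ((N%:R * delta ^+ 2 / sigma ^+ 2)%:E <= elog (local_packing K delta c))%E]].

Definition sup_local_entropy n (K : set (n.-tuple R)) (c : R) : \bar R :=
  ereal_sup [set elog (local_packing K delta c) | delta in [set delta : R | 0 < delta]].

Definition coord n (i : 'I_n) (x : n.-tuple R) : R := tnth x i.

Definition cov_matrix d (Omega : measurableType d) (P : probability Omega R) n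
    (X : Omega -> n.-tuple R) : 'M[R]_n :=
  \matrix_(k, l) fine (covariance P (coord k \o X) (coord l \o X)).

Definition noise_model d (Omega : measurableType d) (P : probability Omega R)
    n N (xi : 'I_N -> Omega -> n.-tuple R) (sigma : R) : Prop :=
  (forall i, measurable_fun [set: Omega] (xi i)) /\
  (forall i j (B : set (n.-tuple R)), measurable B ->
     P (xi i @^-1` B) = P (xi j @^-1` B)) /\
  (forall B : 'I_N -> set (n.-tuple R), (forall i, measurable (B i)) ->
     P (\bigcap_(i in [set: 'I_N]) (xi i @^-1` B i)) =
     (\prod_(i < N) P (xi i @^-1` B i))%E) /\
  (forall i k, (coord k \o xi i) \in Lfun P 2%:E) /\
  (forall i k, ('E_P[coord k \o xi i] = 0)%E) /\
  (forall i (u : 'rV[R]_n),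
     0 <= (u *m (sigma ^+ 2)%:M *m u^T) 0 0 - (u *m cov_matrix P (xi i) *m u^T) 0 0).

Definition sample d (Omega : measurableType d) n N (mu : n.-tuple R)
    (xi : 'I_N -> Omega -> n.-tuple R) (w : Omega) : N.-tuple (n.-tuple R) :=
  [tuple vadd mu (xi i w) | i < N].

Definition adversary n N (eps : R)
    (C : N.-tuple (n.-tuple R) -> N.-tuple (n.-tuple R)) : Prop :=
  measurable_fun [set: N.-tuple (n.-tuple R)] C /\
  forall x, (#|[set i : 'I_N | tnth (C x) i != tnth x i]|%:R <= eps * N%:R).

Definition worst_risk n N (K : set (n.-tuple R)) (sigma eps : R)
    (muhat : N.-tuple (n.-tuple R) -> n.-tuple R) : \bar R :=
  ereal_sup [set r | exists mu, K mu /\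
    exists (d : measure_display) (Omega : measurableType d)
      (P : probability Omega R) (xi : 'I_N -> Omega -> n.-tuple R)
      (C : N.-tuple (n.-tuple R) -> N.-tuple (n.-tuple R)),
      noise_model P xi sigma /\ adversary eps C /\
      r = (\int[P]_w ((edist (muhat (C (sample mu xi w))) mu) ^+ 2)%:E)%E].

Definition minimax_risk n N (K : set (n.-tuple R)) (sigma eps : R) : \bar R :=
  ereal_inf [set worst_risk K sigma eps muhat | muhat in
    [set muhat : N.-tuple (n.-tuple R) -> n.-tuple R |
       measurable_fun [set: N.-tuple (n.-tuple R)] muhat]].

Definition minimax_rate n (K : set (n.-tuple R)) (N : nat) (sigma eps c : R) : \bar R :=
  mine (maxe (delta_star K N sigma c * delta_star K N sigma c)%E
             (eps * sigma ^+ 2)%:E)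
       (diameter K * diameter K)%E.

End Defs.

(* Main.v *)
(** Upper bound.  A single maximal [delta]-packing of [K], with
[delta ^ 2] of the order of [max (delta_star ^ 2) (eps * sigma ^ 2)], carries a
tournament: every pair of points is compared by the sign of a clipped sum of the
projections of the data on the line joining them, and the estimator is the point
whose farthest victorious opponent is nearest.  Its distance to any fixed point
[u] is at most the distance from [u] to the farthest point beating [u], so a union
bound over the packing suffices.  A Chernoff bound shows that a point at distance
[D] beats the one next to the mean with probability at most
[(1 + D ^ 2 / sigma ^ 2) ^ (- 4 r)], [r] proportional to [N]; this covers both
[D <= sigma] and the heavy tails at [D >> sigma].  Local entropy being
nonincreasing in the radius on a star-shaped set, the number of packing points in
the dyadic shell of radius [2 ^ j * delta] is at most [expR H ^+ j.+1] with [H]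
small against [r], and the shells sum to a multiple of [delta ^ 2].

Lower bound.  The noise law may depend on the mean, so all hypotheses can live on a
common finite sample space: signs on a cube centred in the local packing, tilted to
have the prescribed mean, for the entropy term (a chi-square form of Fano's
inequality), and rare outliers which the adversary erases for the [eps * sigma ^ 2]
term. *)

(* With two moments only, the chance that a point at distance [D >> sigma] wins decays as a power of
   [D / sigma], not exponentially. This suffices because the number of packing points also grows
   like a power of the radius: of the exponent [4 * r], one half pays for the count, the other for
   the squared distance and the convergence of the series. The latter half needs
   [r * delta ^ 2 >= sigma ^ 2]. It holds because two points of [K] already give an entropy of
   [ln 2], which forces [delta_star ^ 2 >= sigma ^ 2 / (2 * N)] unless the diameter is at most
   [3 * delta_star], where a constant estimator is good enough. The assumption on [N] bounds the
   entropy at radii above [sigma] by a small multiple of [N], and keeps feasible radii below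
   [sigma], so that the means of the tilted signs lie between -1 and 1. Its constant
   [2 ^ 36 = 64 * 2 ^ 30] matches the clipping level [2 ^ 30 * sigma ^ 2 / D ^ 2], whose test
   tolerates a corrupted fraction of [1 / 64] of the inverse level. *)
Require Import Defs.
From HB Require Import structures.
From mathcomp Require Import all_boot all_order all_algebra.
From mathcomp Require Import all_classical all_reals all_analysis.
From mathcomp Require Import measurable_realfun ring lra.
(* MathComp-Analysis also has an [edist], which would shadow the one of [Defs]. *)
Import Defs.

Set Implicit Arguments.
Unset Strict Implicit.
Unset Printing Implicit Defensive.

Import Order.TTheory GRing.Theory Num.Theory.
Local Open Scope classical_set_scope.
Local Open Scope ring_scope.

(** * Euclidean geometry of tuples and homotheties *)

Section Vectors.
Context {R : realType} {n : nat}.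
Implicit Types (x y z k : n.-tuple R) (t : R).

Definition dot x y : R := \sum_(i < n) tnth x i * tnth y i.

Lemma dotxx_ge0 x : 0 <= dot x x.
Proof. by apply: sumr_ge0 => i _; rewrite -expr2 sqr_ge0. Qed.

Lemma sqr_enorm x : enorm x ^+ 2 = dot x x.
Proof.
rewrite /enorm sqr_sqrtr; first by apply: eq_bigr => i _; rewrite expr2.
by apply: sumr_ge0 => i _; rewrite sqr_ge0.
Qed.

Lemma cauchy_schwarz x y : dot x y ^+ 2 <= dot x x * dot y y.
Proof.
have id a b : \sum_(i < n) (b * tnth x i - a * tnth y i) ^+ 2
    = b ^+ 2 * dot x x - 2 * a * b * dot x y + a ^+ 2 * dot y y.
  rewrite /dot !mulr_sumr -sumrB -big_split /=.
  by apply: eq_bigr => i _; ring.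
have {id} := id (dot x y) (dot y y).
move eqa : (dot x y) => a; move eqb : (dot y y) => b id.
have [b0|b0] := eqVneq b 0.
  have y0 i : tnth y i = 0.
    move/eqP: b0; rewrite -eqb /dot psumr_eq0 => [|j _]; last first.
      by rewrite -expr2 sqr_ge0.
    by move=> /allP /(_ i (mem_index_enum _)) /=; rewrite -expr2 sqrf_eq0 => /eqP.
  by rewrite b0 mulr0 -eqa /dot big1 ?expr0n // => i _; rewrite y0 mulr0.
have bgt : 0 < b by rewrite lt_def b0 -eqb dotxx_ge0.
rewrite -subr_ge0 -(pmulr_rge0 _ bgt).
rewrite (_ : b * _ = \sum_(i < n) (b * tnth x i - a * tnth y i) ^+ 2).
  by apply: sumr_ge0 => i _; rewrite sqr_ge0.
by rewrite id; ring.
Qed.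

Lemma enorm_ge0 x : 0 <= enorm x.
Proof. exact: sqrtr_ge0. Qed.

Lemma dot_le_enorm x y : dot x y <= enorm x * enorm y.
Proof.
apply: le_trans (ler_norm _) _.
rewrite -(ler_pXn2r (n := 2)) ?nnegrE ?mulr_ge0 ?enorm_ge0 //.
by rewrite real_normK ?num_real // exprMn !sqr_enorm cauchy_schwarz.
Qed.

Lemma edist_ge0 x y : 0 <= edist x y.
Proof. exact: enorm_ge0. Qed.

Lemma edistC x y : edist x y = edist y x.
Proof.
rewrite /edist /enorm; congr Num.sqrt; apply: eq_bigr => i _.
by rewrite !tnth_mktuple -sqrrN opprB.
Qed.

Lemma edistxx x : edist x x = 0.
Proof.
rewrite /edist /enorm big1 ?sqrtr0 // => i _.
by rewrite tnth_mktuple subrr expr0n.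
Qed.

Lemma sqr_edist x y : edist x y ^+ 2 = \sum_(i < n) (tnth x i - tnth y i) ^+ 2.
Proof.
by rewrite sqr_enorm; apply: eq_bigr => i _; rewrite !tnth_mktuple expr2.
Qed.

Lemma edist_triangle y x z : edist x z <= edist x y + edist y z.
Proof.
rewrite -(ler_pXn2r (n := 2)) ?nnegrE ?addr_ge0 ?edist_ge0 //.
have := dot_le_enorm (vsub x y) (vsub y z).
rewrite -!/(edist _ _) sqrrD !sqr_edist => h.
have -> : \sum_(i < n) (tnth x i - tnth z i) ^+ 2 =
   \sum_(i < n) (tnth x i - tnth y i) ^+ 2 + \sum_(i < n) (tnth y i - tnth z i) ^+ 2
   + (dot (vsub x y) (vsub y z)) *+ 2.
  rewrite /dot -sumrMnl -!big_split /=; apply: eq_bigr => i _.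
  by rewrite !tnth_mktuple; ring.
by rewrite addrAC lerD2r lerD2l lerMn2r h orbT.
Qed.

Definition homothety k t x := vadd (vscale (1 - t) k) (vscale t x).

Lemma edist_homothety k t x y : 0 <= t ->
  edist (homothety k t x) (homothety k t y) = t * edist x y.
Proof.
move=> t0; apply/eqP; rewrite -(eqrXn2 (n := 2)) ?mulr_ge0 ?edist_ge0 //.
rewrite exprMn !sqr_edist mulr_sumr; apply/eqP; apply: eq_bigr => i _.
by rewrite !tnth_mktuple; ring.
Qed.

Lemma homothety_center k t : homothety k t k = k.
Proof. by apply: eq_from_tnth => i; rewrite !tnth_mktuple; ring. Qed.

Lemma edist_homothety_center k t x : 0 <= t ->
  edist (homothety k t x) k = t * edist x k.
Proof. by move=> t0; rewrite -{2}(homothety_center k t) edist_homothety. Qed.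

End Vectors.

(** * Packings and local entropy of star-shaped sets *)

Section Packings.
Context {R : realType} {n : nat}.
Implicit Types (x y z k : n.-tuple R) (t eta delta c B : R) (K A : set (n.-tuple R))
  (s : seq (n.-tuple R)).

Definition packing eta A s : Prop :=
  (forall x, x \in s -> A x) /\ pairwise (fun x y => eta < edist x y) s.

Lemma packing_filter eta A A' s (p : pred (n.-tuple R)) : packing eta A s ->
  (forall x, p x -> A x -> A' x) -> packing eta A' (seq.filter p s).
Proof.
move=> [sA ps] AA'; split=> [x|].
  by rewrite mem_filter => /andP[px /sA]; apply: AA'.
by rewrite pairwise_filter.
Qed.

Lemma packing_le eta eta' A s : eta' <= eta -> packing eta A s -> packing eta' A s.
Proof.
move=> le [sA ps]; split=> //; apply: sub_pairwise ps => x y /=.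
exact: le_lt_trans.
Qed.

Lemma packing_uniq eta A s : 0 <= eta -> packing eta A s -> uniq s.
Proof.
move=> e0 [_]; rewrite uniq_pairwise; apply: sub_pairwise => x y /=.
by apply: contraTneq => ->; rewrite edistxx -leNgt.
Qed.

(** [pairwise] compares an element with later ones only; symmetry of the distance removes the
    order. *)
Lemma packing_separated eta A s : 0 <= eta -> packing eta A s ->
  forall x y, x \in s -> y \in s -> x != y -> eta < edist x y.
Proof.
move=> e0 [_]; elim: s => [//|a s IH] /= /andP[/allP h ps].
move=> x y; rewrite !inE => /orP[/eqP->|xs] /orP[/eqP->|ys].
- by rewrite eqxx.
- by move=> _; apply: h.
- by move=> _; rewrite edistC; apply: h.
- exact: IH.
Qed.

Lemma local_packing_leP K delta c B :
  (local_packing K delta c <= B%:E)%E <->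
  (forall nu s, K nu -> packing (delta / c) (cball nu delta `&` K) s ->
     (size s)%:R <= B).
Proof.
split=> [h nu s Knu ps|h].
  rewrite -lee_fin; apply: le_trans h.
  apply: (@le_trans _ _ (packing_number (delta / c) (cball nu delta `&` K))).
    by apply: ereal_sup_ubound; exists s.
  by apply: ereal_sup_ubound; exists nu.
apply: ge_ereal_sup => _ [nu Knu <-]; apply: ge_ereal_sup => _ [s ps <-].
by rewrite lee_fin; apply: h ps.
Qed.

Lemma local_packing_gt K delta c (B : \bar R) : (B < local_packing K delta c)%E ->
  exists nu s, [/\ K nu, packing (delta / c) (cball nu delta `&` K) s &
     (B < (size s)%:R%:E)%E].
Proof.
move=> /ereal_sup_gt[_ [nu Knu <-]] /ereal_sup_gt[_ [s ps <-]] h.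
by exists nu, s.
Qed.

Lemma local_packing_ge K delta c nu s : K nu ->
  packing (delta / c) (cball nu delta `&` K) s ->
  ((size s)%:R%:E <= local_packing K delta c)%E.
Proof.
move=> Knu ps.
apply: (@le_trans _ _ (packing_number (delta / c) (cball nu delta `&` K))).
  by apply: ereal_sup_ubound; exists s.
by apply: ereal_sup_ubound; exists nu.
Qed.

Lemma local_packing_ge1 K delta c : 0 <= delta -> (exists x, K x) ->
  (1 <= local_packing K delta c)%E.
Proof.
move=> d0 [x Kx]; apply: (@local_packing_ge _ _ _ x [:: x]) => //; split=> //.
move=> y; rewrite inE => /eqP ->; split=> //.
by rewrite /cball /= edistxx.
Qed.

(** [star_shaped] with its centre exposed; both unfold to the same formula. *)
Definition star_center K k :=
  K k /\ forall x, K x -> forall t, 0 <= t <= 1 -> K (homothety k t x).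

Lemma homothety_packing K k t eta nu delta s : 0 < t <= 1 -> star_center K k ->
  packing eta (cball nu delta `&` K) s ->
  packing (t * eta) (cball (homothety k t nu) (t * delta) `&` K)
    (map (homothety k t) s).
Proof.
move=> /andP[t0 t1] [_ kK] [sA ps]; split.
  move=> _ /mapP[x xs ->]; have [bx Kx] := sA x xs; split.
    by rewrite /cball /= edist_homothety ?(ltW t0) // ler_pM2l.
  by apply: kK => //; rewrite (ltW t0).
rewrite pairwise_map; apply: sub_pairwise ps => x y /=.
by rewrite edist_homothety ?(ltW t0) // ltr_pM2l.
Qed.

(** The homothety of ratio [delta / delta'] at the star centre maps [K] into itself and scales ball
    and separation alike, so a packing at radius [delta'] becomes one of the same size at radius
    [delta]. *)
Lemma local_packing_antimono K k c delta delta' : star_center K k ->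
  0 < delta <= delta' -> (local_packing K delta' c <= local_packing K delta c)%E.
Proof.
move=> sk /andP[d0 dd']; have d'0 : 0 < delta' by apply: lt_le_trans dd'.
pose t := delta / delta'.
have t01 : 0 < t <= 1 by rewrite divr_gt0 //= ler_pdivrMr // mul1r.
have td : t * delta' = delta by rewrite /t divfK // gt_eqF.
apply: ge_ereal_sup => _ [nu Knu <-]; apply: ge_ereal_sup => _ [s ps <-].
have := homothety_packing t01 sk ps; rewrite td mulrA td => ps'.
rewrite -(size_map (homothety k t)); apply: local_packing_ge ps'.
by apply: (proj2 sk) => //; case/andP: t01 => /ltW -> ->.
Qed.

(** A packing that does not cover [A] can be enlarged by an uncovered point; if none covered, sizes
    would grow past [B]. *)
Lemma maximal_packing eta A B :
  (forall s, packing eta A s -> (size s)%:R <= B) ->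
  exists s, packing eta A s /\ (forall x, A x -> exists2 y, y \in s & edist x y <= eta).
Proof.
move=> hB; apply: contrapT => hmax.
suff grow m : exists2 s, packing eta A s & (m <= size s)%N.
  have [s ps sm] := grow (Num.truncn B).+1.
  have := hB _ ps; apply/negP; rewrite -ltNge.
  by apply: lt_le_trans (truncnS_gt B) _; rewrite ler_nat.
elim: m => [|m [s ps sm]]; first by exists [::].
have /existsNP[x /not_implyP[Ax /forall2NP nx]] :
    ~ (forall x, A x -> exists2 y, y \in s & edist x y <= eta).
  by move=> h; apply: hmax; exists s.
exists (x :: s) => //; split.
  by move=> y; rewrite inE => /orP[/eqP->//|]; apply: (proj1 ps).
rewrite pairwise_cons (proj2 ps) andbT; apply/allP => y ys.
by have [//|/negP] := nx y; rewrite -ltNge.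
Qed.

Lemma size_filter_cover (T : eqType) (s : seq T) (t : seq T) (p : T -> pred T) :
  (forall x : T, x \in s -> has (p^~ x) t) ->
  (size s <= \sum_(y <- t) size (seq.filter (p y) s))%N.
Proof.
move=> h.
have -> : (\sum_(y <- t) size (seq.filter (p y) s) =
    \sum_(x <- s) count (p^~ x) t)%N.
  under eq_bigr do rewrite size_filter -sum1_count big_mkcond /=.
  rewrite exchange_big /=; apply: eq_bigr => x _.
  by rewrite -sum1_count [RHS]big_mkcond.
rewrite -sum1_size big_seq [X in (_ <= X)%N]big_seq.
by apply: leq_sum => x xs; rewrite -has_count h.
Qed.

(* Cover the ball of radius [2 ^ j.+1 * delta] by balls of half that radius
   centred at a maximal packing, and recurse. *)
Lemma packing_ball_count K delta c B : 2 <= c -> 0 < delta ->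
  (forall i : nat, (local_packing K (2 ^+ i * delta) c <= B%:E)%E) ->
  forall j nu s, K nu -> packing delta (cball nu (2 ^+ j * delta) `&` K) s ->
  (size s)%:R <= B ^+ j.+1.
Proof.
move=> c2 d0 hB; elim=> [|j IH] nu s Knu ps.
  have /local_packing_leP h := hB 0%N; rewrite expr1; apply: (h nu) => //.
  rewrite expr0 mul1r in ps *; apply: packing_le ps.
  by rewrite ler_pdivrMr ?ler_peMr ?ltW //; lra.
have /local_packing_leP h := hB j.+1.
have [t [pt ct]] := maximal_packing (fun s ps => h nu s Knu ps).
have B1 : (size t)%:R <= B by apply: (h nu).
have B0 : 0 <= B by apply: le_trans B1.
pose p y := [pred x | edist x y <= 2 ^+ j * delta].
(* [2 <= c] makes the covering radius at most half of the radius of the ball. *)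
have cov x : x \in s -> has (p^~ x) t.
  move=> xs; have [y yt xy] := ct x ((proj1 ps) x xs).
  apply/hasP; exists y => //=; apply: le_trans xy _.
  rewrite ler_pdivrMr; last by lra.
  rewrite exprS -!mulrA mulrC -!mulrA ler_pM2l ?exprn_gt0 //.
  by rewrite mulrC [leRHS]mulrC ler_pM2r.
have := size_filter_cover cov; rewrite -(ler_nat R) => /le_trans; apply.
rewrite natr_sum exprS.
apply: (@le_trans _ _ (\sum_(y <- t) B ^+ j.+1)); last first.
  by rewrite big_const_seq count_predT iter_addr_0 -[leLHS]mulr_natl
    ler_wpM2r // exprn_ge0.
rewrite big_seq [leRHS]big_seq; apply: ler_sum => y yt.
have [_ Ky] := (proj1 pt) y yt.
apply: (IH y) => //; apply: (packing_filter ps) => x px [_ Kx]; split=> //.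
Qed.

End Packings.

(** * Expectation of a product of functions of independent variables *)

Section FiniteValued.
Context d (Omega : measurableType d) {R : realType} (P : probability Omega R).

Lemma ge0_integral_finvalued (J : finType) (G : Omega -> J) (phi : J -> R) :
  (forall j, measurable (G @^-1` [set j])) -> (forall j, 0 <= phi j) ->
  (\int[P]_w (phi (G w))%:E = \sum_(j : J) (phi j)%:E * P (G @^-1` [set j]))%E.
Proof.
move=> mG phi0.
have mi j : measurable_fun [set: Omega] (EFin \o (\1_(G @^-1` [set j]) : Omega -> R)).
  by apply/measurable_EFinP; apply: measurable_indic.
transitivity (\int[P]_w (\sum_(j : J) (phi j)%:E * (\1_(G @^-1` [set j]) w)%:E))%E.
  apply: eq_integral => w _.
  rewrite (bigD1 (G w)) //= big1 => [|j jG].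
    by rewrite indicE mem_set // mule1 adde0.
  by rewrite indicE memNset ?mule0 // => Gwj; rewrite -Gwj eqxx in jG.
rewrite ge0_integral_sum //=; [|by move=> j; apply: measurable_funeM; exact: mi
  |by move=> j w _; rewrite mule_ge0 ?lee_fin].
apply: eq_bigr => j _.
rewrite ge0_integralZl_EFin //=; [|exact: mi].
by rewrite integral_indic // setIT.
Qed.

(** Independence is given as a product rule for preimages. Rounding [f] up to a grid of mesh
    [rho' - rho] reduces the claim to a finite sum over cells, where that rule applies directly;
    rounding costs at most the mesh in each factor, whence [rho'] in place of [rho]. *)
Lemma ge0_integral_prod_indep_le d' (T : measurableType d') (N : nat)
    (xi : 'I_N -> Omega -> T) (f : T -> R) (M rho rho' : R) :
  (forall i, measurable_fun [set: Omega] (xi i)) ->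
  (forall B : 'I_N -> set T, (forall i, measurable (B i)) ->
     P (\bigcap_(i in [set: 'I_N]) (xi i @^-1` B i)) =
     (\prod_(i < N) P (xi i @^-1` B i))%E) ->
  measurable_fun [set: T] f -> (forall x, 0 <= f x <= M) ->
  (forall i, (\int[P]_w (f (xi i w))%:E <= rho%:E)%E) -> rho < rho' ->
  (\int[P]_w (\prod_(i < N) f (xi i w))%:E <= (rho' ^+ N)%:E)%E.
Proof.
move=> mxi indep mf f0M frho rr'.
pose eta := rho' - rho.
have eta0 : 0 < eta by rewrite subr_gt0.
pose m := (Num.truncn (M / eta)).
(* [g x] is the index of the grid cell of [f x] and [c] gives its upper end, so [c (g x)] exceeds
   [f x] by at most [eta]. *)
pose g (x : T) : 'I_m.+1 := inord (Num.truncn (f x / eta)).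
pose c (a : 'I_m.+1) : R := eta * a.+1%:R.
have c0 a : 0 <= c a by rewrite mulr_ge0 ?ltW.
have gE x : g x = Num.truncn (f x / eta) :> nat.
  rewrite /g inordK // ltnS /m; apply: le_truncn.
  by rewrite ler_pM2r ?invr_gt0 //; case/andP: (f0M x).
have fc x : f x <= c (g x) <= f x + eta.
  have /andP[fx0 _] := f0M x.
  have fe : 0 <= f x / eta by rewrite divr_ge0 // ltW.
  have /andP[h1 h2] := truncn_itv fe.
  rewrite /c gE; apply/andP; split.
    by rewrite mulrC -ler_pdivrMr // ltW.
  rewrite -natr1 mulrDr mulr1 lerD2r mulrC -ler_pdivlMr //.
have mg a : measurable (g @^-1` [set a]).
  have -> : g @^-1` [set a] = f @^-1` `[eta * a%:R, eta * a.+1%:R[.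
    apply/seteqP; split=> x /=.
      move=> <-; rewrite gE in_itv /=.
      have /andP[fx0 _] := f0M x.
      have /andP[h1 h2] := truncn_itv (divr_ge0 fx0 (ltW eta0)).
      by rewrite mulrC -ler_pdivlMr // h1 mulrC -ltr_pdivrMr.
    rewrite in_itv /= => /andP[h1 h2]; apply/val_inj; rewrite /= gE.
    have /andP[fx0 _] := f0M x.
    apply/eqP; rewrite truncn_eq ?divr_ge0 ?(ltW eta0) //.
    by rewrite ler_pdivlMr // mulrC h1 ltr_pdivrMr // mulrC h2.
  by rewrite -[X in measurable X]setTI; apply: mf => //; exact: measurable_itv.
have mxg i a : measurable (xi i @^-1` (g @^-1` [set a])).
  by rewrite -[X in measurable X]setTI; apply: mxi.
pose p i a : R := fine (P (xi i @^-1` (g @^-1` [set a]))).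
have pE i a : P (xi i @^-1` (g @^-1` [set a])) = (p i a)%:E.
  by rewrite fineK // fin_num_measure.
have mfxi i : measurable_fun [set: Omega] (fun w => (f (xi i w))%:E).
  by apply/measurable_EFinP; apply: measurableT_comp.
have sum_le i : \sum_(a : 'I_m.+1) c a * p i a <= rho'.
  rewrite -lee_fin -sumEFin.
  under eq_bigr do rewrite EFinM -pE.
  rewrite -(@ge0_integral_finvalued _ (g \o xi i)) //=.
  apply: (@le_trans _ _ (\int[P]_w ((f (xi i w))%:E + eta%:E))%E).
    apply: ge0_le_integral => //=.
    - by move=> w _; rewrite lee_fin.
    - apply/measurable_EFinP; apply: (measurableT_comp (f := c \o g)) => //.
      move=> _ B mB; rewrite setTI.
      have -> : (c \o g) @^-1` B = \bigcup_(a in [set a | B (c a)]) g @^-1` [set a].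
        by apply/seteqP; split=> [x /= Bx|x [a /= Ba ->]//]; exists (g x).
      apply: fin_bigcup_measurable => //; exact: finite_finset.
    - by apply: emeasurable_funD.
    - by move=> w _; rewrite lee_fin; case/andP: (fc (xi i w)).
  rewrite ge0_integralD //=.
  - rewrite integral_cst //= probability_setT mule1.
    have -> : rho'%:E = (rho%:E + eta%:E)%E by rewrite -EFinD /eta addrC subrK.
    by rewrite leeD2r.
  - by move=> w _; rewrite lee_fin; case/andP: (f0M (xi i w)).
  - by move=> w _; rewrite lee_fin ltW.
  - exact: mxg.
(* The fibres of [G] are intersections of one preimage for each coordinate, exactly what the product
   rule evaluates. *)
pose G w : {ffun 'I_N -> 'I_m.+1} := [ffun i => g (xi i w)].
have GE h : G @^-1` [set h] =
    \bigcap_(i in [set: 'I_N]) (xi i @^-1` (g @^-1` [set h i])).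
  apply/seteqP; split=> w /=; first by move=> <- i _; rewrite /= ffunE.
  by move=> hw; apply/ffunP => i; rewrite ffunE; apply: hw.
have mG h : measurable (G @^-1` [set h]).
  rewrite GE; apply: fin_bigcap_measurable => //; exact: finite_finset.
apply: (@le_trans _ _ (\int[P]_w ((\prod_(i < N) c (G w i))%:E))%E).
  apply: ge0_le_integral => //=.
  - by move=> w _; rewrite lee_fin prodr_ge0 // => i _; case/andP: (f0M (xi i w)).
  - apply/measurable_EFinP; apply: measurable_prod => i _.
    by apply: measurableT_comp.
  - apply/measurable_EFinP => _ B mB; rewrite setTI.
    set F := fun w => _.
    have -> : F @^-1` B = \bigcup_(h in [set h : {ffun 'I_N -> 'I_m.+1} |
        B (\prod_(i < N) c (h i))]) G @^-1` [set h].
      apply/seteqP; split=> [x /= Bx|x [h Bh Gx]]; first by exists (G x).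
      by move: Bh; rewrite -Gx.
    apply: fin_bigcup_measurable => //; exact: finite_finset.
  - move=> w _; rewrite lee_fin; apply: ler_prod => i _.
    rewrite ffunE; case/andP: (fc (xi i w)) => -> _.
    by case/andP: (f0M (xi i w)) => ->.
rewrite (@ge0_integral_finvalued _ G (fun h => \prod_(i < N) c (h i))) //; last first.
  by move=> h; apply: prodr_ge0.
under eq_bigr => h _.
  rewrite GE indep; last by move=> i; exact: mg.
  under [X in (_ * X)%E]eq_bigr do rewrite pE.
  rewrite prodEFin -EFinM -big_split /=.
  over.
rewrite sumEFin lee_fin -(bigA_distr_bigA (fun i a => c a * p i a)) /=.
rewrite -[X in _ <= _ ^+ X]card_ord -prodr_const; apply: ler_prod => i _.
rewrite sum_le andbT; apply: sumr_ge0 => a _.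
by rewrite mulr_ge0 // fine_ge0.
Qed.

End FiniteValued.

(** * Moments of the noise projected on a direction *)

Section DirectionalMoments.
Context d (Omega : measurableType d) {R : realType} (P : probability Omega R).

Lemma Lfun_sum (p : \bar R) (p1 : (1 <= p)%E) (I : Type) (s : seq I) (F : I -> Omega -> R) :
  (forall i, F i \in Lfun P p) -> (fun w => \sum_(i <- s) F i w) \in Lfun P p.
Proof.
move=> hF; rewrite (_ : (fun w => _) = \sum_(i <- s) F i); last first.
  by apply/funext => w; rewrite fct_sumE.
by apply: rpred_sum.
Qed.

Lemma expectation_fun_sum (I : Type) (s : seq I) (F : I -> Omega -> R) :
  (forall i, F i \in Lfun P 1%E) ->
  ('E_P[(fun w => \sum_(i <- s) F i w)%R] = \sum_(i <- s) 'E_P[F i])%E.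
Proof.
move=> hF; elim: s => [|i s IH].
  rewrite big_nil; under eq_fun do rewrite big_nil.
  exact: expectation_cst.
rewrite big_cons -IH -expectationD //; last exact: Lfun_sum.
by congr expectation; apply/funext => w; rewrite big_cons.
Qed.

Context (n N : nat) (xi : 'I_N -> Omega -> n.-tuple R) (sigma : R).
Hypothesis nm : noise_model P xi sigma.
Variables (i : 'I_N) (v : n.-tuple R).
Let Y w := dot (xi i w) v.

Let coordL2 k : coord k \o xi i \in Lfun P 2%:E.
Proof. by case: nm => _ [_ [_ [h _]]]. Qed.

Let finP : P [set: Omega] \is a fin_num.
Proof. by rewrite probability_setT. Qed.

Let coordL1 k : coord k \o xi i \in Lfun P 1%E.
Proof. exact: (Lfun_subset12 finP). Qed.

Let YE : Y = fun w => \sum_k (tnth v k \o* (coord k \o xi i)) w.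
Proof. by []. Qed.

Lemma noise_dot_Lfun2 : Y \in Lfun P 2%:E.
Proof.
rewrite YE; apply: Lfun_sum => [|k]; first by rewrite lee_fin ler1n.
by apply: Lfun_scale => //; rewrite ler1n.
Qed.

Lemma noise_dot_expectation : ('E_P[Y] = 0)%E.
Proof.
rewrite YE expectation_fun_sum => [|k]; last by apply: Lfun_scale.
apply: big1 => k _; rewrite expectationZl //.
by case: nm => _ [_ [_ [_ [-> _]]]]; rewrite mule0.
Qed.

(** The square expands into products of coordinates, whose expectations are covariances because the
    means vanish; what remains is the covariance hypothesis at the row vector [v]. *)
Lemma noise_dot_sqr_expectation :
  ('E_P[(fun w => Y w ^+ 2)%R] <= (sigma ^+ 2 * dot v v)%:E)%E.
Proof.
pose F (kl : 'I_n * 'I_n) :=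
  (tnth v kl.1 * tnth v kl.2) \o* ((coord kl.1 \o xi i) \* (coord kl.2 \o xi i)).
have L1 kl : ((coord kl.1 \o xi i) \* (coord kl.2 \o xi i)) \in Lfun P 1%E.
  exact: Lfun2_mul_Lfun1.
have -> : (fun w => Y w ^+ 2) = (fun w => \sum_kl F kl w).
  apply/funext => w; rewrite expr2 YE mulr_suml.
  rewrite -(pair_bigA _ (fun k l => F (k, l) w)) /=; apply: eq_bigr => k _.
  by rewrite mulr_sumr; apply: eq_bigr => l _; rewrite /F /=; ring.
rewrite expectation_fun_sum => [|kl]; last exact: Lfun_scale.
have covE k l : covariance P (coord k \o xi i) (coord l \o xi i) =
    ('E_P[(coord k \o xi i) \* (coord l \o xi i)])%E.
  rewrite covarianceE //; last exact: (L1 (k, l)).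
  case: nm => _ [_ [_ [_ [h0 _]]]].
  by rewrite !h0 mule0 sube0.
have finE : forall k l, ('E_P[(coord k \o xi i) \* (coord l \o xi i)])%E \is a fin_num.
  by move=> k l; apply: expectation_fin_num; apply: (L1 (k, l)).
case: nm => _ [_ [_ [_ [_ /(_ i (\row_k tnth v k))]]]].
rewrite subr_ge0 => quad.
rewrite (eq_bigr (fun kl => (tnth v kl.1 * tnth v kl.2 *
    fine 'E_P[((coord kl.1 \o xi i) \* (coord kl.2 \o xi i))%R])%:E)); last first.
  by move=> kl _; rewrite expectationZl // -(fineK (finE kl.1 kl.2)) -EFinM.
rewrite sumEFin lee_fin.
rewrite (_ : \sum_(kl : 'I_n * 'I_n) _ = (\row_k tnth v k *m cov_matrix P (xi i)
   *m (\row_k tnth v k)^T) 0 0); last first.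
  rewrite !mxE -(pair_bigA _ (fun k l => tnth v k * tnth v l *
    fine 'E_P[(coord k \o xi i) \* (coord l \o xi i)])) exchange_big /=.
  apply: eq_bigr => l _; rewrite !mxE mulr_suml; apply: eq_bigr => k _.
  by rewrite !mxE covE; ring.
apply: le_trans quad _.
rewrite mul_mx_scalar -scalemxAl !mxE ler_wpM2l ?sqr_ge0 //.
by apply: ler_sum => k _; rewrite !mxE.
Qed.

(** Integrating a quadratic majorant in the projection takes two moments: the linear term vanishes
    by centring. The tests use the moments of the noise in this form alone. *)
Lemma noise_quadratic_le (f : n.-tuple R -> R) (a b c : R) :
  measurable_fun [set: n.-tuple R] f -> (forall x, 0 <= f x) -> 0 <= c ->
  (forall x, f x <= a + b * dot x v + c * dot x v ^+ 2) ->
  (\int[P]_w (f (xi i w))%:E <= (a + c * (sigma ^+ 2 * dot v v))%:E)%E.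
Proof.
move=> mf f0 c0 fq.
have mxi : measurable_fun [set: Omega] (xi i) by case: nm.
have Y2 := noise_dot_Lfun2.
have Y1 : Y \in Lfun P 1%E by exact: (Lfun_subset12 finP).
have YY : (fun w => Y w ^+ 2) \in Lfun P 1%E.
  rewrite (_ : (fun w => _) = Y \* Y); first exact: Lfun2_mul_Lfun1.
  by apply/funext => w; rewrite expr2.
pose Q := (cst a \+ (b \o* Y)) \+ (c \o* (fun w => Y w ^+ 2)).
have QL : Q \in Lfun P 1%E.
  apply: rpredD => //; last exact: Lfun_scale.
  by apply: rpredD => //; [exact: Lfun_cst|exact: Lfun_scale].
apply: (@le_trans _ _ 'E_P[Q]%E).
  rewrite unlock; apply: ge0_le_integral => //=.
  - by move=> w _; rewrite lee_fin.
  - by apply/measurable_EFinP; apply: measurableT_comp.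
  - by apply/measurable_EFinP; move/sub_Lfun_mfun: QL; rewrite inE.
  - move=> w _; rewrite lee_fin; apply: le_trans (fq _) _.
    by rewrite [b * _]mulrC [c * _]mulrC.
rewrite /Q !expectationD //=; [|exact: Lfun_cst|exact: Lfun_scale
   |by apply: rpredD => //; [exact: Lfun_cst|exact: Lfun_scale]|exact: Lfun_scale].
rewrite expectation_cst !expectationZl // noise_dot_expectation mule0 adde0.
rewrite EFinD leeD2l // EFinM lee_wpmul2l ?lee_fin //.
exact: noise_dot_sqr_expectation.
Qed.

End DirectionalMoments.

(** * Exponential moment of a clipped variable *)

Section Clipping.
Context {R : realType}.
Implicit Types (m t : R).

Definition clip m t : R := Num.max (- m) (Num.min m t).

Lemma clip_cases m t : 0 < m ->
  [\/ clip m t = m /\ m <= t, clip m t = t /\ - m <= t <= m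
    | clip m t = - m /\ t <= - m].
Proof.
move=> m0; rewrite /clip; case: (leP m t) => [mt|tm].
  by apply: Or31; rewrite max_r //; lra.
case: (leP (- m) t) => [mt|tm'].
  by apply: Or32; split=> //; rewrite (ltW tm).
by apply: Or33; split=> //; exact: ltW.
Qed.

Lemma clipN m t : 0 < m -> clip m (- t) = - clip m t.
Proof.
move=> m0; case: (clip_cases t m0) => -[-> h]; case: (clip_cases (- t) m0) => -[-> h']; lra.
Qed.

Lemma clip_bounded m t : 0 < m -> - m <= clip m t <= m.
Proof. move=> m0; case: (clip_cases t m0) => -[-> h]; lra. Qed.

(** For [t <= - m] the gap is [(t + 2 * m) ^ 2 / (4 * m)], zero at [t = - 2 * m], which dictates the
    coefficient. *)
Lemma clip_le_quadratic m t : 0 < m -> clip m t <= t + t ^+ 2 / (4 * m).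
Proof.
move=> m0; rewrite -lerBlDl ler_pdivlMr ?mulr_gt0 //.
case: (clip_cases t m0) => -[-> h].
- by have := sqr_ge0 (t - 2 * m); nra.
- by rewrite subrr mul0r sqr_ge0.
- by have := sqr_ge0 (t + 2 * m); nra.
Qed.

Lemma sqr_clip_le m t : 0 < m -> clip m t ^+ 2 <= t ^+ 2.
Proof.
move=> m0; case: (clip_cases t m0) => -[-> h] //; rewrite -subr_ge0 subr_sqr.
- by apply: mulr_ge0; lra.
- by apply: mulr_le0; lra.
Qed.

(** [expR x <= 1 / (1 - x)], and [(1 - x) * (1 + x + 2 * x ^ 2) = 1 + x ^ 2 * (1 - 2 * x)]. *)
Lemma expR_le_quadratic (x : R) : x <= 2^-1 -> expR x <= 1 + x + 2 * x ^+ 2.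
Proof.
move=> x2; have := expR_ge1Dx (- x); rewrite expRN => h.
have x1 : 0 < 1 - x by lra.
have : expR x <= (1 - x)^-1 by rewrite -[leLHS]invrK lef_pV2 ?posrE ?invr_gt0 ?expR_gt0.
move=> /le_trans; apply.
by rewrite -[leLHS]mul1r ler_pdivrMr //; nra.
Qed.

(** In [3 / 16], [1 / 16] comes from comparing [clip m t] with [t] in the linear term and [2 / 16]
    from the second-order term of the exponential. *)
Lemma expR_clip_le m t : 0 < m ->
  expR (clip m t / (4 * m)) <= 1 + t / (4 * m) + 3 / 16 * (t / m) ^+ 2.
Proof.
move=> m0; have m0' : m != 0 by rewrite gt_eqF.
have cb := clip_bounded t m0; have cq := clip_le_quadratic t m0.
have cs := sqr_clip_le t m0.
apply: le_trans (expR_le_quadratic _) _.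
  by rewrite ler_pdivrMr ?mulr_gt0 //; lra.
have -> : t / (4 * m) = (t + t ^+ 2 / (4 * m)) / (4 * m) - (t / m) ^+ 2 / 16 by field.
have -> : (clip m t / (4 * m)) ^+ 2 = clip m t ^+ 2 / (16 * m ^+ 2) by field.
have -> : (t / m) ^+ 2 = 16 * (t ^+ 2 / (16 * m ^+ 2)) by field.
have : clip m t / (4 * m) <= (t + t ^+ 2 / (4 * m)) / (4 * m).
  by rewrite ler_pM2r ?invr_gt0 ?mulr_gt0.
have : clip m t ^+ 2 / (16 * m ^+ 2) <= t ^+ 2 / (16 * m ^+ 2).
  by rewrite ler_pM2r ?invr_gt0 ?mulr_gt0 ?exprn_gt0.
lra.
Qed.

End Clipping.

(** * Pairwise tests and their error probabilities *)

Section Score.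
Context {R : realType} {n : nat}.
Implicit Types (u v x mu : n.-tuple R) (sigma : R).

(** Affine in [x], equal to [- 4] at [u] and to [4] at [v]: a positive value is a vote for [v]. *)
Definition score u v x : R :=
  4 * (edist x u ^+ 2 - edist x v ^+ 2) / edist u v ^+ 2.

Lemma scoreC u v x : score v u x = - score u v x.
Proof. by rewrite /score (edistC v u) -[RHS]mulNr -[X in _ = X / _]mulrN opprB. Qed.

Lemma score_shift u v mu x :
  score u v (vadd mu x) = score u v mu + 8 / edist u v ^+ 2 * dot x (vsub v u).
Proof.
rewrite /score !sqr_edist.
rewrite [in LHS](_ : _ - _ = \sum_(i < n) (tnth mu i - tnth u i) ^+ 2
   - \sum_(i < n) (tnth mu i - tnth v i) ^+ 2 + 2 * dot x (vsub v u)); last first.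
  rewrite /dot mulr_sumr -!sumrB -big_split /=; apply: eq_bigr => i _.
  by rewrite !tnth_mktuple; ring.
by ring.
Qed.

Lemma dot_vsub u v : dot (vsub v u) (vsub v u) = edist u v ^+ 2.
Proof. by rewrite -sqr_enorm edistC. Qed.

Lemma score_center_bounds u v mu : 0 < edist u v -> edist mu u <= edist u v / 8 ->
  - 6 <= score u v mu <= - 3.
Proof.
move=> D0 h; have := edist_triangle u mu v; have := edist_triangle mu u v.
rewrite (edistC u mu) /score; have := edist_ge0 mu u; have := edist_ge0 mu v.
move: D0 h; move: (edist mu u) (edist mu v) (edist u v) => a b D D0 ha b0 a0 h1 h2.
by rewrite ler_pdivlMr ?ler_pdivrMr ?exprn_gt0 //; nra.
Qed.

Lemma sqr_score_center_le u v mu : 0 < edist u v -> edist mu u <= edist u v / 8 ->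
  score u v mu ^+ 2 <= 26.
Proof.
move=> D0 h; have := edist_triangle u mu v; have := edist_triangle mu u v.
rewrite (edistC u mu) /score; have := edist_ge0 mu u; have := edist_ge0 mu v.
move: D0 h; move: (edist mu u) (edist mu v) (edist u v) => a b D D0 ha b0 a0 h1 h2.
rewrite -sqrrN -mulNr -[X in X / _]mulrN opprB.
have : 0 <= 4 * (b ^+ 2 - a ^+ 2) / D ^+ 2 <= 81/16.
  by rewrite ler_pdivlMr ?ler_pdivrMr ?exprn_gt0 //; nra.
move: (4 * _ / _) => z hz; nra.
Qed.

Lemma measurable_score u v : measurable_fun [set: n.-tuple R] (score u v).
Proof.
have msq w : measurable_fun [set: n.-tuple R] (fun x => edist x w ^+ 2).
  under eq_fun do rewrite sqr_edist.
  apply: measurable_sum => i; apply: measurable_funX; apply: measurable_funB => //.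
  exact: measurable_tnth.
apply: measurable_funM => //; apply: measurable_funM => //.
exact: measurable_funB.
Qed.

Lemma measurable_clip (m : R) : measurable_fun [set: R] (clip m).
Proof. by apply: measurable_maxr => //; exact: measurable_minr. Qed.

End Score.

Section Testing.
Context {R : realType} {n N : nat}.
Implicit Types (u v x mu : n.-tuple R) (sigma m : R) (X : N.-tuple (n.-tuple R)).

Definition clip_sum m u v X : R := \sum_(i < N) clip m (score u v (tnth X i)).

Lemma clip_sumC m u v X : 0 < m -> clip_sum m v u X = - clip_sum m u v X.
Proof.
move=> m0; rewrite /clip_sum -sumrN; apply: eq_bigr => i _.
by rewrite scoreC clipN.
Qed.

(* Far apart points ([m = 1]) are compared by a plain majority vote, the closer
   ones by a mean clipped at the variance scale. *)
Definition level sigma u v : R :=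
  if edist u v ^+ 2 <= 2 ^+ 25 * sigma ^+ 2 then 2 ^+ 30 * sigma ^+ 2 / edist u v ^+ 2
  else 1.

Lemma levelC sigma u v : level sigma u v = level sigma v u.
Proof. by rewrite /level edistC. Qed.

Lemma level_gt0 sigma u v : 0 < sigma -> 0 < edist u v -> 0 < level sigma u v.
Proof.
by move=> s0 D0; rewrite /level; case: ifP => // _; rewrite divr_gt0 ?mulr_gt0 ?exprn_gt0.
Qed.

Definition beats sigma v u X : bool := 0 <= clip_sum (level sigma u v) u v X.

(** Exchanging the points changes the sign of the clipped sum; in a tie each beats the other. *)
Lemma beats_total sigma u v X : 0 < sigma -> 0 < edist u v ->
  beats sigma v u X || beats sigma u v X.
Proof.
move=> s0 D0; rewrite /beats (levelC sigma v u) (clip_sumC _ _ _ (level_gt0 s0 D0)).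
by rewrite oppr_ge0 le_total.
Qed.

Lemma measurable_clip_sum m u v :
  measurable_fun [set: N.-tuple (n.-tuple R)] (clip_sum m u v).
Proof.
apply: measurable_sum => i.
apply: measurableT_comp (measurable_clip m) _.
apply: measurableT_comp (measurable_score u v) _.
exact: measurable_tnth.
Qed.

Lemma measurable_beats sigma v u : measurable [set X | beats sigma v u X].
Proof.
have -> : [set X | beats sigma v u X] =
    clip_sum (level sigma u v) u v @^-1` `[0, +oo[.
  by apply/seteqP; split=> X /=; rewrite /beats in_itv /= andbT.
by rewrite -[X in measurable X]setTI; apply: measurable_clip_sum.
Qed.

Lemma adversary_card eps (C : N.-tuple (n.-tuple R) -> N.-tuple (n.-tuple R)) X :
  adversary eps C ->
  \sum_(i < N) (tnth (C X) i != tnth X i)%:R <= eps * N%:R.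
Proof.
move=> [_ /(_ X)]; apply: le_trans; rewrite -natr_sum ler_nat.
rewrite -sum1_card [leqRHS]big_mkcond /=; apply: leq_sum => i _.
by case: ifP => // /negP; rewrite inE /= => /negP/negPf ->.
Qed.

Context d (Omega : measurableType d) (P : probability Omega R).
Variables (xi : 'I_N -> Omega -> n.-tuple R) (sigma eps : R).
Variable C : N.-tuple (n.-tuple R) -> N.-tuple (n.-tuple R).
Hypotheses (nm : noise_model P xi sigma) (adv : adversary eps C).
Hypotheses (s0 : 0 < sigma) (eps32 : eps <= 32^-1).

Lemma measurable_corrupted_sample mu :
  measurable_fun [set: Omega] (fun w => C (sample mu xi w)).
Proof.
apply: (measurableT_comp (f := C)); first by case: adv.
apply/measurable_fun_tnthP => i; apply/measurable_fun_tnthP => k.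
rewrite (_ : _ \o _ = (fun w => tnth mu k + tnth (xi i w) k)); last first.
  by apply/funext => w /=; rewrite !tnth_mktuple.
apply: measurable_funD => //.
apply: (measurableT_comp (f := fun x : n.-tuple R => tnth x k)); first exact: measurable_tnth.
by case: nm.
Qed.

(** Markov's inequality for the product of the [f (xi i w)]. Leaving [f] free allows an exponential
    weight for close points and a two-valued one for far points. *)
Lemma noise_chernoff (v : n.-tuple R) (f : n.-tuple R -> R) (M a b c rho t : R)
    (E : set Omega) : measurable E ->
  measurable_fun [set: n.-tuple R] f -> (forall x, 0 <= f x <= M) -> 0 <= c -> 0 < t ->
  (forall x, f x <= a + b * dot x v + c * dot x v ^+ 2) ->
  a + c * (sigma ^+ 2 * dot v v) < rho ->
  (forall w, E w -> t <= \prod_(i < N) f (xi i w)) ->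
  (P E <= (rho ^+ N / t)%:E)%E.
Proof.
move=> mE mf f0M c0 t0 fq hrho hE.
have mxi : forall i, measurable_fun [set: Omega] (xi i) by case: nm.
have f0 x : 0 <= f x by case/andP: (f0M x).
have indep := proj1 (proj2 (proj2 nm)).
have intle := ge0_integral_prod_indep_le mxi indep mf f0M
  (fun i => noise_quadratic_le nm i mf f0 c0 fq) hrho.
rewrite -[P E](_ : (\int[P]_w (\1_E w : R)%:E)%E = _); last first.
  by rewrite integral_indic // setIT.
rewrite mulrC EFinM.
have F0 w : 0 <= \prod_(i < N) f (xi i w) by apply: prodr_ge0.
have mF : measurable_fun [set: Omega] (fun w => (\prod_(i < N) f (xi i w))%:E).
  apply/measurable_EFinP; apply: measurable_prod => i _.
  exact: measurableT_comp.
apply: (@le_trans _ _ (\int[P]_w ((t^-1)%:E * (\prod_(i < N) f (xi i w))%:E))%E).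
  apply: ge0_le_integral => //=.
  - by apply/measurable_EFinP; apply: measurable_indic.
  - exact: measurable_funeM.
  - move=> w _; rewrite -EFinM lee_fin indicE.
    have [/set_mem Ew|] := boolP (w \in E); last by rewrite mulr_ge0 // invr_ge0 ltW.
    by rewrite mulrC ler_pdivlMr // mul1r hE.
rewrite ge0_integralZl_EFin //=; last 2 first.
- by move=> w _; rewrite lee_fin.
- by rewrite invr_ge0 ltW.
by rewrite lee_wpmul2l // lee_fin invr_ge0 ltW.
Qed.

End Testing.

Section TestError.
Context {R : realType} {n N : nat}.
Context d (Omega : measurableType d) (P : probability Omega R).
Variables (xi : 'I_N -> Omega -> n.-tuple R) (sigma eps : R).
Variable C : N.-tuple (n.-tuple R) -> N.-tuple (n.-tuple R).
Hypotheses (nm : noise_model P xi sigma) (adv : adversary eps C).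
Hypotheses (s0 : 0 < sigma) (eps32 : eps <= 32^-1).
Variables (mu u v : n.-tuple R).
Hypotheses (D0 : 0 < edist u v) (near_u : edist mu u <= edist u v / 8).
Let D := edist u v.
Let s := score u v mu.
Let event := [set w | beats sigma v u (C (sample mu xi w))].

Let measurable_event : measurable event.
Proof.
rewrite (_ : event = (fun w => C (sample mu xi w)) @^-1` [set X | beats sigma v u X]) //.
rewrite -[X in measurable X]setTI; apply: (measurable_corrupted_sample nm adv) => //.
exact: measurable_beats.
Qed.

Lemma measurable_shifted_score m : measurable_fun [set: n.-tuple R]
  (fun x => clip m (score u v (vadd mu x))).
Proof.
apply: measurableT_comp (measurable_clip m) _.
apply: measurableT_comp (measurable_score u v) _.
apply/measurable_fun_tnthP => k.
rewrite (_ : _ \o _ = (fun x => tnth mu k + tnth x k)); last first.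
  by apply/funext => x /=; rewrite !tnth_mktuple.
by apply: measurable_funD => //; exact: measurable_tnth.
Qed.

(** One factor has expectation at most [1 - 3 / (4 * m)] plus second-order terms below
    [1 / (4 * m)], hence less than [expR (- (2 * m)^-1)]. The adversary moves the sum by at most
    [2 * m] for each of [eps * N] points, a factor [expR (eps * N / 2)] that is at most
    [expR (N / (4 * m))]. *)
Lemma test_error_close (m := 2 ^+ 30 * sigma ^+ 2 / D ^+ 2) :
  D ^+ 2 <= 2 ^+ 25 * sigma ^+ 2 -> 64 * m * eps <= 1 ->
  (P event <= (expR (- (N%:R / (4 * m))))%:E)%E.
Proof.
move=> Dle meps.
have D20 : 0 < D ^+ 2 by rewrite exprn_gt0.
have S20 : 0 < sigma ^+ 2 by rewrite exprn_gt0.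
have m0 : 0 < m by rewrite /m divr_gt0 ?mulr_gt0 ?exprn_gt0.
have q1 : 64 <= 2 ^+ 25 :> R.
  by rewrite (_ : 64 = 2 ^+ 6); [rewrite ler_weXn2l ?ler1n|ring].
have q2 : 2 ^+ 30 = 32 * 2 ^+ 25 :> R by rewrite -[30%N]/(5 + 25)%N exprD; congr (_ * _); ring.
have m32 : 32 <= m.
  by rewrite /m ler_pdivlMr // q2 -mulrA ler_pM2l.
have hs : - 6 <= s <= - 3 by apply: score_center_bounds.
have hs2 : s ^+ 2 <= 26 by apply: sqr_score_center_le.
have level_m : level sigma u v = m by rewrite /level -/D Dle.
have sE : sigma ^+ 2 = m * D ^+ 2 / (32 * 2 ^+ 25).
  by rewrite /m -q2 divfK ?gt_eqF // mulrAC divff ?mul1r // gt_eqF // exprn_gt0.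
clearbody m.
pose f x := expR (clip m (score u v (vadd mu x)) / (4 * m)).
pose beta := 8 / D ^+ 2.
(* [a], [b], [c] are the coefficients in [y] of [1 + (s + beta * y) / (4 * m) + 3 / 16 * ((s + beta
   * y) / m) ^ 2]; [t] accounts for the corruption. *)
apply: (le_trans (noise_chernoff nm (v := vsub v u) (f := f) (M := expR 1)
  (a := 1 + s / (4 * m) + 3 / 16 * (s / m) ^+ 2)
  (b := beta / (4 * m) + 3 / 8 * (s * beta / m ^+ 2))
  (c := 3 / 16 * (beta / m) ^+ 2) (rho := expR (- (2 * m)^-1))
  (t := expR (- (eps * N%:R / 2))) measurable_event _ _ _ _ _ _ _)).
- apply: measurableT_comp => //; apply: measurable_funM => //.
  exact: measurable_shifted_score.
- move=> x; rewrite expR_ge0 ler_expR ler_pdivrMr ?mulr_gt0 //.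
  by have := clip_bounded (score u v (vadd mu x)) m0; lra.
- by apply: mulr_ge0 => //; exact: sqr_ge0.
- exact: expR_gt0.
- move=> x; apply: le_trans (expR_clip_le _ m0) _.
  rewrite score_shift -/s -/beta; move: (dot _ _) => y.
  rewrite le_eqVlt; apply/orP; left; apply/eqP.
  by field; rewrite gt_eqF.
- apply: lt_le_trans (expR_ge1Dx _).
  rewrite dot_vsub -/D.
  have -> : 3 / 16 * (beta / m) ^+ 2 * (sigma ^+ 2 * D ^+ 2)
    = 3 / 16 * (2 / 2 ^+ 25) / m.
    rewrite sE /beta; move: (2 ^+ 25) q1 => q q1.
    by field; rewrite !gt_eqF //=; lra.
  have -> : (s / m) ^+ 2 = s ^+ 2 / m / m by field; rewrite gt_eqF.
  have h1 : s ^+ 2 / m <= 26 / 32.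
    by rewrite ler_pdivrMr //; lra.
  have h2 : 2 / 2 ^+ 25 <= 1 / 32 :> R.
    by rewrite ler_pdivrMr ?exprn_gt0 //; lra.
  have h3 : s ^+ 2 / m / m <= 26 / 32 / m by rewrite ler_pM2r ?invr_gt0.
  have h4 : 3 / 16 * (2 / 2 ^+ 25) / m <= 3 / 16 * (1 / 32) / m.
    by rewrite ler_pM2r ?invr_gt0 // ler_pM2l.
  have h5 : s / (4 * m) <= - 3 / 4 / m.
    rewrite (_ : s / (4 * m) = s / 4 / m); last by field; rewrite gt_eqF.
    by rewrite ler_pM2r ?invr_gt0 //; lra.
  have h6 : (2 * m)^-1 = 1 / 2 / m by field; rewrite gt_eqF.
  have i0 : 0 < m^-1 by rewrite invr_gt0.
  by rewrite h6; lra.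
- move=> w; rewrite /event /= /beats level_m => ev.
  rewrite /f -expR_sum ler_expR -mulr_suml.
  pose X := sample mu xi w.
  have -> : \sum_(i < N) clip m (score u v (vadd mu (xi i w))) = clip_sum m u v X.
    by apply: eq_bigr => i _; rewrite tnth_mktuple.
  have diff : clip_sum m u v (C X) - clip_sum m u v X <= 2 * m * (eps * N%:R).
    apply: (@le_trans _ _ (2 * m * \sum_(i < N) (tnth (C X) i != tnth X i)%:R)); last first.
      by rewrite ler_pM2l ?mulr_gt0 //; exact: adversary_card.
    rewrite /clip_sum -sumrB mulr_sumr; apply: ler_sum => i _.
    have [->|_] := eqVneq (tnth (C X) i) (tnth X i); first by rewrite subrr mulr0.
    have := clip_bounded (score u v (tnth (C X) i)) m0.
    by have := clip_bounded (score u v (tnth X i)) m0; rewrite mulr1; lra.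
  rewrite ler_pdivlMr ?mulr_gt0 //.
  by move: diff ev; rewrite -/X; lra.
rewrite lee_fin -expRM_natl -expRN -expRD ler_expR opprK.
have -> : N%:R / (4 * m) = N%:R * (1 / 4 / m) by field; rewrite gt_eqF.
have -> : N%:R * - (2 * m)^-1 = - (N%:R * (1 / 2 / m)) by field; rewrite gt_eqF.
have h : eps <= 1 / 64 / m by rewrite ler_pdivlMr //; lra.
have := ler_wpM2l (ler0n R N) h; have : 0 <= N%:R * m^-1 by apply: divr_ge0 => //; exact: ltW.
lra.
Qed.

(** If [v] wins, at least a quarter of the noise vectors project past a quarter of the way from [u]
    to [v]. Such a vector gets weight [1 + x], where [x = D ^ 2 / sigma ^ 2 / 16] is the inverse of
    the Chebyshev bound on its probability: each factor has expectation at most [2], while the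
    product is at least [x] to the power [N / 4]. *)
Lemma test_error_far : 2 ^+ 25 * sigma ^+ 2 < D ^+ 2 ->
  (P event <= (4 ^+ N / expR (ln (D ^+ 2 / sigma ^+ 2 / 16) * (N%:R / 4)))%:E)%E.
Proof.
move=> Dgt.
have level1 : level sigma u v = 1 by rewrite /level -/D leNgt Dgt.
have D20 : 0 < D ^+ 2 by rewrite exprn_gt0.
have S20 : 0 < sigma ^+ 2 by rewrite exprn_gt0.
have q1 : 64 <= 2 ^+ 25 :> R.
  by rewrite (_ : 64 = 2 ^+ 6); [rewrite ler_weXn2l ?ler1n|ring].
pose x := D ^+ 2 / sigma ^+ 2 / 16; rewrite -/x.
have x1 : 1 <= x.
  rewrite /x ler_pdivlMr // ler_pdivlMr // mul1r.
  by apply: le_trans (ltW Dgt); rewrite ler_pM2r //; lra.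
have x0 : 0 < x by lra.
have l0 : 0 <= ln x by apply: ln_ge0.
pose bad y := D ^+ 2 / 4 <= dot y (vsub v u).
pose f y : R := 1 + x * (bad y)%:R.
have fE y : f y = if bad y then 1 + x else 1.
  by rewrite /f; case: (bad y); rewrite ?mulr1 ?mulr0 ?addr0.
have hs : - 6 <= s <= - 3 by apply: score_center_bounds.
apply: (noise_chernoff nm (v := vsub v u) (f := f) (M := 1 + x)
  (a := 1) (b := 0) (c := (sigma ^+ 2 * D ^+ 2)^-1) measurable_event).
- apply: measurable_funD => //; apply: measurable_funM => //.
  rewrite (_ : (fun y => _) = \1_[set y | bad y]); last first.
    apply/funext => y; rewrite indicE; congr (_%:R : R).
    by apply: congr1; apply/idP/idP => [h|/set_mem//]; exact/mem_set.
  apply: measurable_indic.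
  rewrite (_ : [set y | bad y] = (fun y => dot y (vsub v u)) @^-1` `[D ^+ 2 / 4, +oo[).
    rewrite -[X in measurable X]setTI.
    have : measurable_fun [set: n.-tuple R] (fun y => dot y (vsub v u)).
      apply: measurable_sum => i; apply: measurable_funM => //; exact: measurable_tnth.
    by apply.
  by apply/seteqP; split=> y /=; rewrite in_itv /= andbT.
- by move=> y; rewrite fE; case: (bad y); lra.
- by rewrite invr_ge0 mulr_ge0 // ltW.
- exact: expR_gt0.
- move=> y; rewrite mul0r addr0 fE /bad; case: ifP => [|_]; last first.
    by rewrite lerDl mulr_ge0 ?sqr_ge0 // invr_ge0 mulr_ge0 // ltW.
  move: (dot _ _) => z hz; rewrite lerD2l mulrC ler_pdivlMr ?mulr_gt0 //.
  rewrite (_ : x * _ = (D ^+ 2 / 4) ^+ 2); last first.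
    by rewrite /x; field; rewrite gt_eqF.
  have d0 : 0 <= D ^+ 2 / 4 by rewrite divr_ge0 // ltW.
  by rewrite ler_pXn2r // nnegrE (le_trans d0 hz).
- by rewrite dot_vsub -/D mulVf ?gt_eqF ?mulr_gt0 //; lra.
- move=> w; rewrite /event /= /beats level1 => ev.
  pose X := sample mu xi w.
  have card_bad : N%:R / 4 <= \sum_(i < N) (bad (xi i w))%:R :> R.
    (* An unmodified point without large noise scores at most [- 3 + 2] and counts [- 1]; any other
       point counts at most [1]. *)
    have step : clip_sum 1 u v (C X) <= \sum_(i < N)
        (2 * (tnth (C X) i != tnth X i)%:R + 2 * (bad (xi i w))%:R - 1).
      apply: ler_sum => i _.
      have := clip_bounded (score u v (tnth (C X) i)) (@ltr01 R).
      have [->|_] := eqVneq (tnth (C X) i) (tnth X i); last first.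
        by have : 0 <= (bad (xi i w))%:R :> R by []; rewrite mulr1; lra.
      have [_|hb] := boolP (bad (xi i w)); first by rewrite mulr0 mulr1; lra.
      move=> _; rewrite !mulr0 add0r.
      have hsc : score u v (tnth X i) <= - 1.
        rewrite tnth_mktuple score_shift -/s -/D.
        have : 8 / D ^+ 2 * dot (xi i w) (vsub v u) <= 2.
          rewrite mulrAC ler_pdivrMr //.
          by move: hb; rewrite /bad -ltNge; lra.
        lra.
      by case: (clip_cases (score u v (tnth X i)) (@ltr01 R)) => -[-> ?]; lra.
    move: step; rewrite sumrB big_split /= -!mulr_sumr sumr_const card_ord => step.
    have := adversary_card X adv; have N0 : 0 <= N%:R :> R by [].
    have := ler_wpM2r N0 eps32.
    by move: ev; rewrite -/X; lra.
  have -> : \prod_(i < N) f (xi i w) = \prod_(i < N) f (xi i w) * 1 by rewrite mulr1.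
  apply: (@le_trans _ _ (\prod_(i < N) expR (ln x * (bad (xi i w))%:R))).
    by rewrite -expR_sum -mulr_sumr ler_expR ler_wpM2l.
  rewrite mulr1; apply: ler_prod => i _; rewrite expR_ge0 /= fE.
  by case: (bad _); rewrite ?mulr1 ?mulr0 ?expR0 // lnK ?posrE //; lra.
Qed.

(** Close points use [1 + x <= expR x]; far points already have a power bound. A common form lets
    the shells be summed uniformly. *)
Lemma test_error (r : nat) : 2 ^+ 36 * eps * sigma ^+ 2 <= D ^+ 2 ->
  4 * r%:R * 2 ^+ 32 <= N%:R :> R ->
  (P event <= ((1 + D ^+ 2 / sigma ^+ 2) ^+ (4 * r))^-1%:E)%E.
Proof.
move=> Deps hr.
have D20 : 0 < D ^+ 2 by rewrite exprn_gt0.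
have S20 : 0 < sigma ^+ 2 by rewrite exprn_gt0.
have r0 : 0 <= r%:R :> R by [].
pose x := D ^+ 2 / sigma ^+ 2; rewrite -/x.
have x0 : 0 < x by rewrite divr_gt0.
have p0 : 0 < (1 + x) ^+ (4 * r) by rewrite exprn_gt0 //; lra.
have [Dle|Dgt] := leP (D ^+ 2) (2 ^+ 25 * sigma ^+ 2).
  apply: le_trans (test_error_close Dle _) _.
    rewrite (_ : 64 * _ * eps = 2 ^+ 36 * eps * sigma ^+ 2 / D ^+ 2).
      by rewrite ler_pdivrMr // mul1r.
    by rewrite (_ : 2 ^+ 36 = 64 * 2 ^+ 30); [ring|rewrite -[36%N]/(6 + 30)%N exprD; ring].
  rewrite lee_fin expRN lef_pV2 ?posrE ?expR_gt0 //.
  apply: (@le_trans _ _ (expR x ^+ (4 * r))).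
    by rewrite lerXn2r ?nnegrE ?expR_ge0 ?expR_ge1Dx //; lra.
  rewrite -expRM_natl ler_expR.
  have -> : N%:R / (4 * (2 ^+ 30 * sigma ^+ 2 / D ^+ 2)) = N%:R / 2 ^+ 32 * x.
    rewrite /x (_ : 2 ^+ 32 = 4 * 2 ^+ 30); last by rewrite -[32%N]/(2 + 30)%N exprD; ring.
    have : 0 < 2 ^+ 30 :> R by rewrite exprn_gt0.
    by move: (2 ^+ 30) => q q0; field; rewrite !gt_eqF.
  by rewrite ler_pM2r // natrM ler_pdivlMr ?exprn_gt0.
apply: le_trans (test_error_far Dgt) _.
rewrite lee_fin -/x -[leRHS]mul1r ler_pdivlMr // mulrAC ler_pdivrMr ?expR_gt0 // mul1r.
have x25 : 2 ^+ 25 < x by rewrite /x ltr_pdivlMr.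
have q1 : 1 <= 2 ^+ 25 :> R by rewrite exprn_ege1 // ler1n.
have e4 : 4 ^+ N = expR (ln 4 * N%:R) :> R.
  by rewrite mulrC expRM_natl lnK ?posrE.
have ex : (1 + x) ^+ (4 * r) = expR (ln (1 + x) * (4 * r)%:R).
  by rewrite mulrC expRM_natl lnK ?posrE //; lra.
rewrite e4 ex -expRD ler_expR.
have l0 : 0 <= ln (1 + x) by apply: ln_ge0; lra.
have hN : ln (1 + x) * (4 * r)%:R <= ln (1 + x) * (N%:R / 8).
  rewrite ler_wpM2l // natrM; apply: le_trans (_ : N%:R / 2 ^+ 32 <= _).
    by rewrite ler_pdivlMr ?exprn_gt0.
  rewrite ler_wpM2l // lef_pV2 ?posrE ?exprn_gt0 //.
  by rewrite (_ : 8 = 2 ^+ 3); [rewrite ler_weXn2l ?ler1n|ring].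
apply: le_trans (lerD (lexx _) hN) _.
clearbody x.
(* Exponentiated, this is [2 ^ 24 * (1 + x) <= x ^ 2], true above the threshold [2 ^ 25] that
   separates the regimes. *)
have key : 8 * ln 4 + ln (1 + x) <= 2 * ln (x / 16).
  rewrite (_ : 8 * ln 4 = ln (4 ^+ 8)); last by rewrite lnXn // mulr_natl.
  rewrite (_ : 2 * ln (x / 16) = ln ((x / 16) ^+ 2)); last first.
    by rewrite lnXn ?divr_gt0 // mulr_natl.
  have x10 : 0 < 1 + x by lra.
  rewrite -lnM ?posrE ?exprn_gt0 // ler_ln ?posrE ?mulr_gt0 ?exprn_gt0 ?divr_gt0 //.
  have -> : (x / 16) ^+ 2 = x * x / 256 by field.
  rewrite ler_pdivlMr // mulrAC (_ : 4 ^+ 8 * 256 = 2 ^+ 24); last first.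
    by rewrite (_ : 4 = 2 ^+ 2); [rewrite (_ : 256 = 2 ^+ 8); [rewrite -exprM -exprD|ring]|ring].
  apply: (@le_trans _ _ (2 ^+ 25 * x)); last by rewrite ler_pM2r // ltW.
  have p0' : 0 < 2 ^+ 24 :> R by rewrite exprn_gt0.
  have x1 : 1 <= x by lra.
  by rewrite [2 ^+ 25]exprS -mulrA mulrCA ler_pM2l //; lra.
have N0 : 0 <= N%:R / 8 :> R by rewrite divr_ge0.
by have := ler_wpM2r N0 key; lra.
Qed.

End TestError.

Lemma measurable_fun_finfactor d (T : measurableType d) d' (T' : measurableType d')
    (J : finType) (phi : T -> J) (F : J -> T') :
  (forall j, measurable (phi @^-1` [set j])) ->
  measurable_fun [set: T] (F \o phi).
Proof.
move=> mphi _ B mB; rewrite setTI.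
have -> : (F \o phi) @^-1` B = \bigcup_(j in [set j | B (F j)]) phi @^-1` [set j].
  by apply/seteqP; split=> [x /= Bx|x [j /= Bj ->]//]; exists (phi x).
by apply: fin_bigcup_measurable => //; exact: finite_finset.
Qed.

(** * The tournament estimator and its risk *)

Section Tournament.
Context {R : realType} {n N : nat} (I : finType) (g : I -> n.-tuple R) (i0 : I).
Hypothesis g_sep : forall i j, i != j -> 0 < edist (g i) (g j).
Implicit Types (b : {ffun I * I -> bool}) (X : N.-tuple (n.-tuple R)) (k : I).

Definition radius b k : R := \big[Num.max/0]_(j | b (j, k)) edist (g k) (g j).

Definition winner b : I := [arg min_(i < i0) radius b i]%O.

Definition outcomes sigma X : {ffun I * I -> bool} :=
  [ffun ij => beats sigma (g ij.1) (g ij.2) X].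

Definition tournament sigma X : n.-tuple R := g (winner (outcomes sigma X)).

Lemma measurable_tournament sigma :
  measurable_fun [set: N.-tuple (n.-tuple R)] (tournament sigma).
Proof.
apply: (measurable_fun_finfactor (phi := outcomes sigma) (fun b => g (winner b))) => b.
rewrite (_ : _ @^-1` _ = \bigcap_(ij in [set: I * I])
    [set X | beats sigma (g ij.1) (g ij.2) X = b ij]).
  apply: fin_bigcap_measurable => [|ij _]; first exact: finite_finset.
  have mb := @measurable_beats R n N sigma (g ij.1) (g ij.2).
  case: (b ij) => //.
  rewrite (_ : [set X | _] = ~` [set X | beats sigma (g ij.1) (g ij.2) X]).
    exact: measurableC.
  by apply/seteqP; split=> X /=; [move=> ->|move/negP/negPf].
apply/seteqP; split=> X /=; first by move=> <- ij _; rewrite /= ffunE.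
by move=> h; apply/ffunP => ij; rewrite ffunE; apply: h.
Qed.

(** The maximum is either at most [rho] or one of the terms of the sum; taking expectations then
    performs the union bound. *)
Lemma radius_sqr_le b k rho : 0 <= rho ->
  radius b k ^+ 2 <= rho ^+ 2 + \sum_(j | rho < edist (g k) (g j))
     edist (g k) (g j) ^+ 2 * (b (j, k))%:R.
Proof.
move=> rho0; set S := \sum_(j | _) _.
have S0 : 0 <= S by apply: sumr_ge0 => j _; rewrite mulr_ge0 ?sqr_ge0.
rewrite /radius; elim/big_ind: _ => [|x y hx hy|j bj].
- by rewrite expr0n addr_ge0 ?sqr_ge0.
- by case: (leP x y).
- have [le|gt] := leP (edist (g k) (g j)) rho.
    apply: (@le_trans _ _ (rho ^+ 2)); last by rewrite lerDl.
    by rewrite lerXn2r ?nnegrE ?edist_ge0.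
  rewrite /S (bigD1 j) //= bj mulr1.
  set S' := \sum_(_ | _) _.
  have S'0 : 0 <= S' by apply: sumr_ge0 => ? _; rewrite mulr_ge0 ?sqr_ge0.
  by have := sqr_ge0 rho; lra.
Qed.

(** If [k] beats the winner, their distance is at most the radius of the winner, which is minimal;
    if the winner beats [k], it is at most the radius of [k]. *)
Lemma edist_tournament sigma X k : 0 < sigma ->
  edist (tournament sigma X) (g k) <= radius (outcomes sigma X) k.
Proof.
move=> s0; rewrite /tournament; set b := outcomes sigma X; set W := winner b.
have radius0 i : 0 <= radius b i.
  by rewrite /radius; elim/big_ind: _ => [//|x y hx hy|j _]; [case: (leP x y)|exact: edist_ge0].
have Wmin : radius b W <= radius b k.
  by rewrite /W /winner; case: arg_minP => // i _; apply.
have [->|Wk] := eqVneq W k; first by rewrite edistxx.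
have le_radius i j : b (j, i) -> edist (g i) (g j) <= radius b i.
  by move=> bji; rewrite /radius (bigD1 j) //= le_max lexx.
have := beats_total X s0 (g_sep Wk).
have -> : beats sigma (g k) (g W) X = b (k, W) by rewrite ffunE.
have -> : beats sigma (g W) (g k) X = b (W, k) by rewrite ffunE.
move=> /orP[h|h].
  exact: le_trans (le_radius _ _ h) Wmin.
by rewrite edistC; apply: le_radius.
Qed.

Context d (Omega : measurableType d) (P : probability Omega R).
Variables (xi : 'I_N -> Omega -> n.-tuple R) (sigma eps : R).
Variable C : N.-tuple (n.-tuple R) -> N.-tuple (n.-tuple R).
Hypotheses (nm : noise_model P xi sigma) (adv : adversary eps C).
Hypotheses (s0 : 0 < sigma) (eps32 : eps <= 32^-1).

Lemma measurable_sqr_edist d' (T : measurableType d') (F : T -> n.-tuple R) x :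
  measurable_fun [set: T] F -> measurable_fun [set: T] (fun t => edist (F t) x ^+ 2).
Proof.
move=> mF; under eq_fun do rewrite sqr_edist.
apply: measurable_sum => i; apply: measurable_funX; apply: measurable_funB => //.
exact: measurableT_comp (measurable_tnth _) mF.
Qed.

(** With [a] the distance from the estimate to [g k], the loss is at most
    [2 * a ^ 2 + 2 * delta ^ 2] and [a ^ 2] at most [64 * delta ^ 2] plus the far sum, whence [130].
    Beyond [8 * delta], [mu] is close enough to [g k] for the test bound. *)
Lemma tournament_risk (mu : n.-tuple R) k delta (r : nat) : 0 <= delta ->
  edist mu (g k) <= delta -> 2 ^+ 36 * eps * sigma ^+ 2 <= delta ^+ 2 ->
  4 * r%:R * 2 ^+ 32 <= N%:R :> R ->
  (\int[P]_w (edist (tournament sigma (C (sample mu xi w))) mu ^+ 2)%:E <=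
   (130 * delta ^+ 2 + 2 * \sum_(j | 8 * delta < edist (g k) (g j))
      edist (g k) (g j) ^+ 2 *
      ((1 + edist (g k) (g j) ^+ 2 / sigma ^+ 2) ^+ (4 * r))^-1)%:E)%E.
Proof.
move=> d0 muk deps hr.
pose ev j := [set w | beats sigma (g j) (g k) (C (sample mu xi w))].
have mCs := measurable_corrupted_sample nm adv mu.
have mev j : measurable (ev j).
  rewrite (_ : ev j = (fun w => C (sample mu xi w)) @^-1` [set X | beats sigma (g j) (g k) X]) //.
  by rewrite -[X in measurable X]setTI; apply: mCs => //; exact: measurable_beats.
have mind j : measurable_fun [set: Omega] (fun w => (\1_(ev j) w : R)%:E).
  by apply/measurable_EFinP; apply: measurable_indic.
pose D j := edist (g k) (g j).
pose far := [seq j <- index_enum I | 8 * delta < D j].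
pose bound w : \bar R := ((130 * delta ^+ 2)%:E +
  \sum_(j <- far) (2 * D j ^+ 2)%:E * (\1_(ev j) w)%:E)%E.
have mterm j : measurable_fun [set: Omega]
    (fun w => ((2 * D j ^+ 2)%:E * (\1_(ev j) w)%:E)%E).
  exact: measurable_funeM.
have term0 j w : (0 <= (2 * D j ^+ 2)%:E * (\1_(ev j) w)%:E)%E.
  rewrite -EFinM lee_fin; apply: mulr_ge0 => //.
  by apply: mulr_ge0 => //; exact: sqr_ge0.
apply: (@le_trans _ _ (\int[P]_w bound w)%E).
  apply: ge0_le_integral => //=.
  - by move=> w _; rewrite lee_fin sqr_ge0.
  - apply/measurable_EFinP; apply: measurable_sqr_edist.
    exact: measurableT_comp (measurable_tournament sigma) mCs.
  - by apply: emeasurable_funD => //; apply: emeasurable_sum.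
  - move=> w _; set X := C _.
    rewrite /bound; under eq_bigr do rewrite -EFinM.
    rewrite sumEFin -EFinD lee_fin.
    have h1 := edist_tournament X k s0.
    have h2 := radius_sqr_le (outcomes sigma X) k (mulr_ge0 (ler0n R 8) d0).
    have h3 := edist_triangle (g k) (tournament sigma X) mu.
    have -> : \sum_(j <- far) 2 * D j ^+ 2 * \1_(ev j) w =
       2 * \sum_(j | 8 * delta < edist (g k) (g j))
         edist (g k) (g j) ^+ 2 * (outcomes sigma X (j, k))%:R.
      rewrite big_filter mulr_sumr; apply: eq_bigr => j _; rewrite ffunE /= -mulrA indicE.
      congr (_ * (_ * _%:R)); apply: congr1.
      by apply/idP/idP => [/set_mem//|h]; exact/mem_set.
    move: (edist_ge0 (tournament sigma X) (g k)) (edist_ge0 (tournament sigma X) mu) muk.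
    rewrite (edistC mu).
    move: (\sum_(j | _) _) (edist (tournament _ _) (g k)) (edist (tournament _ _) mu)
      (edist (g k) mu) (radius _ _) h1 h2 h3 => S a b c rad h1 h2 h3 h4 h5 h6.
    have : b ^+ 2 <= (a + delta) ^+ 2 by rewrite lerXn2r ?nnegrE //; lra.
    have : a ^+ 2 <= rad ^+ 2 by rewrite lerXn2r ?nnegrE //; lra.
    have := sqr_ge0 (a - delta); rewrite !expr2; rewrite expr2 in h2; nra.
rewrite ge0_integralD //=; last first.
- by apply: emeasurable_sum.
- by move=> w _; apply: sume_ge0.
- by move=> w _; rewrite lee_fin mulr_ge0 ?sqr_ge0.
rewrite integral_cst //= probability_setT mule1 EFinD leeD2l //.
rewrite ge0_integral_sum //= mulr_sumr -sumEFin /far big_filter.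
apply: lee_sum => j farj.
rewrite ge0_integralZl_EFin //=; last first.
- by rewrite mulr_ge0 ?sqr_ge0.
rewrite integral_indic // setIT.
have hP : (P (ev j) <= ((1 + D j ^+ 2 / sigma ^+ 2) ^+ (4 * r))^-1%:E)%E.
  apply: (test_error nm adv s0 eps32) => //.
  - by apply: le_lt_trans farj; rewrite mulr_ge0.
  - by rewrite edistC in muk; rewrite edistC (le_trans muk) // ler_pdivlMr // mulrC ltW.
  - apply: le_trans deps _.
    rewrite lerXn2r ?nnegrE ?edist_ge0 //.
    by apply: le_trans (ltW farj); lra.
apply: le_trans (lee_wpmul2l _ hP) _; first by rewrite lee_fin mulr_ge0 ?sqr_ge0.
by rewrite -EFinM lee_fin mulrA.
Qed.
End Tournament.

(** * Summation over dyadic shells *)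

Section ShellSums.
Context {R : realType}.
Implicit Types (H y : R) (l r : nat).

Lemma bernoulli_ge y r : 0 <= y -> 1 + r%:R * y <= (1 + y) ^+ r.
Proof.
move=> y0; elim: r => [|r IH]; first by rewrite mul0r addr0.
rewrite exprS; apply: (@le_trans _ _ ((1 + y) * (1 + r%:R * y))); last first.
  by rewrite ler_pM2l //; lra.
have : 0 <= r%:R :> R by []. rewrite -natr1; nra.
Qed.

Lemma expR_half_le m : 0 <= m <= 1 -> expR (m / 2) <= 1 + m :> R.
Proof.
move=> /andP[m0 m1]; have := expR_ge1Dx (- (m / 2)); rewrite expRN => h.
have p : 0 < 1 - m / 2 by lra.
have : expR (m / 2) <= (1 - m / 2)^-1.
  by rewrite -[leLHS]invrK lef_pV2 ?posrE ?invr_gt0 ?expR_gt0.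
by move=> /le_trans; apply; rewrite -[leLHS]mul1r ler_pdivrMr //; nra.
Qed.

(** Each induction step multiplies by [expR (m / 2) <= 1 + m], and
    [(1 + q * m) * (1 + m) <= 1 + 4 * q * m] when [0 <= m <= 1 <= q]. *)
Lemma expR_min_le (x0 : R) l : 0 < x0 -> expR (l%:R * (Num.min x0 1 / 2)) <= 1 + 4 ^+ l * x0.
Proof.
move=> x00; set m := Num.min x0 1.
have m01 : 0 <= m <= 1 by rewrite /m le_min ge_min lexx orbT ltW //= ler01.
have mx : m <= x0 by rewrite /m ge_min lexx.
apply: (@le_trans _ _ (1 + 4 ^+ l * m)); last first.
  by rewrite lerD2l ler_pM2l ?exprn_gt0.
elim: l => [|l IH]; first by rewrite mul0r expR0 expr0; lra.
rewrite -natr1 mulrDl mul1r expRD.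
have := expR_half_le m01; have := expR_gt0 (m / 2); have := expR_gt0 (l%:R * (m / 2)).
have p4 : 1 <= 4 ^+ l :> R by rewrite exprn_ege1 // ler1n.
move: (expR _) (expR _) IH => a b IH a0 b0 hb; rewrite exprS.
apply: (@le_trans _ _ ((1 + 4 ^+ l * m) * (1 + m))).
  by apply: ler_pM => //; exact: ltW.
case/andP: m01 => m0 m1; move: (4 ^+ l) p4 => q p4.
have : 0 <= q * m by rewrite mulr_ge0 //; lra.
nra.
Qed.

(** Half of the exponent absorbs the number of points, as [l + 2 <= 2 * l]; the other half dominates
    [(4 ^ l) ^ 2] by Bernoulli and [1 <= r * x0], one factor for the squared distance and one for
    the decay. *)
Lemma shell_term_le (x0 : R) H l r : 0 < x0 -> 0 <= H -> H <= r%:R * Num.min x0 1 / 2 ->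
  1 <= r%:R * x0 -> (2 <= l)%N ->
  expR H ^+ (l + 2) * 4 ^+ l * ((1 + 4 ^+ l * x0) ^+ (4 * r))^-1 <= (4 ^+ l)^-1.
Proof.
move=> x00 H0 Hr rx l2.
have q0 : 0 < 4 ^+ l :> R by rewrite exprn_gt0.
have y0 : 0 < 4 ^+ l * x0 by rewrite mulr_gt0.
set y := 4 ^+ l * x0 in y0 *.
have py n : 0 < (1 + y) ^+ n by rewrite exprn_gt0 //; lra.
have e1 : expR H ^+ (l + 2) <= (1 + y) ^+ (2 * r).
  have := expR_min_le l x00; rewrite -/y.
  rewrite -(ler_pXn2r (n := 2 * r)) ?nnegrE ?expR_ge0 //; last 2 first.
  - by case: r Hr rx {py} => // _; rewrite mul0r ler10.
  - by lra.
  apply: le_trans; rewrite -!expRM_natl ler_expR !natrM natrD.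
  have l2R : 2 <= l%:R :> R by rewrite ler_nat.
  apply: (@le_trans _ _ (2 * l%:R * H)); first by rewrite ler_wpM2r //; lra.
  have -> : 2 * r%:R * (l%:R * (Num.min x0 1 / 2)) = 2 * l%:R * (r%:R * Num.min x0 1 / 2) by ring.
  by rewrite ler_wpM2l // mulr_ge0.
have e2 : (4 ^+ l) ^+ 2 <= (1 + y) ^+ (2 * r).
  rewrite mulnC exprM; rewrite lerXn2r ?nnegrE ?(ltW q0) ?(ltW (py _)) //.
  apply: le_trans (bernoulli_ge r (ltW y0)).
  have -> : r%:R * y = 4 ^+ l * (r%:R * x0) by rewrite /y; ring.
  have : 4 ^+ l * 1 <= 4 ^+ l * (r%:R * x0) by rewrite ler_pM2l.
  lra.
rewrite ler_pdivrMr // [leRHS]mulrC ler_pdivlMr // -mulrA -expr2.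
rewrite (_ : 4 * r = 2 * r + 2 * r)%N; last by rewrite -mulnDl.
by rewrite [leRHS]exprD; apply: ler_pM => //; rewrite ?exprn_ge0 ?expR_ge0.
Qed.

Lemma geometric_shells (J : nat) : \sum_(j < J) (4 ^+ (j + 3))^-1 <= 1 / 48 :> R.
Proof.
suff : \sum_(j < J) (4 ^+ (j + 3))^-1 = 1 / 48 - (4 ^+ J)^-1 / 48 :> R.
  by move=> ->; rewrite lerBlDr lerDl divr_ge0 // invr_ge0 exprn_ge0.
elim: J => [|J IH]; first by rewrite big_ord0 expr0; field.
rewrite big_ord_recr /= IH exprD [4 ^+ J.+1]exprS.
have : 0 < 4 ^+ J :> R by rewrite exprn_gt0.
by move: (4 ^+ J) => q q0; field; rewrite gt_eqF.
Qed.

End ShellSums.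

Section UpperBound.
Context {R : realType} {n N : nat}.
Implicit Types (K : set (n.-tuple R)) (k u x : n.-tuple R) (delta sigma eps H : R)
  (s : seq (n.-tuple R)).

Lemma dyadic_shell (delta y : R) (J : nat) : 0 < delta -> 8 * delta < y ->
  y <= J%:R * delta ->
  exists2 j : nat, (j < J)%N & 2 ^+ (j + 3) * delta < y <= 2 ^+ (j + 4) * delta.
Proof.
move=> d0 y8 yJ.
have hJ : y <= 2 ^+ (J + 3) * delta.
  apply: le_trans yJ _; rewrite ler_pM2r //.
  apply: (@le_trans _ _ (2 ^ (J + 3))%N%:R); last by rewrite natrX.
  by rewrite ler_nat (leq_trans _ (ltnW (ltn_expl _ _))) // leq_addr.
elim: J {yJ} hJ => [|J IH] hJ.
  by move: hJ; rewrite add0n leNgt (_ : 2 ^+ 3 = 8) ?y8 //; ring.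
have [le|gt] := leP y (2 ^+ (J + 3) * delta).
  by have [j jJ h] := IH le; exists j => //; exact: ltnW.
by exists J => //; rewrite gt /= (_ : J + 4 = J.+1 + 3)%N // addnS.
Qed.

(** In a shell, the squared distance is bounded at the outer radius and the probability at the inner
    one, a loss of [4]; points are counted in the whole outer ball. The total is at most
    [4 * delta ^ 2 / 48]. *)
Lemma far_sum_le K delta sigma H s u (r : nat) :
  0 < delta -> 0 < sigma -> K u -> packing delta K s ->
  (forall i : nat, (local_packing K (2 ^+ i * delta) 2 <= (expR H)%:E)%E) ->
  0 <= H -> H <= r%:R * Num.min (delta ^+ 2 / sigma ^+ 2) 1 / 2 ->
  1 <= r%:R * (delta ^+ 2 / sigma ^+ 2) ->
  \sum_(v <- s | 8 * delta < edist u v) edist u v ^+ 2 *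
     ((1 + edist u v ^+ 2 / sigma ^+ 2) ^+ (4 * r))^-1 <= delta ^+ 2.
Proof.
move=> d0 s0 Ku ps hloc H0 Hr rx.
set x0 := delta ^+ 2 / sigma ^+ 2.
have x00 : 0 < x0 by rewrite divr_gt0 // exprn_gt0.
pose J := (\max_(v <- s) (Num.truncn (edist u v / delta)).+1)%N.
have JP v : v \in s -> edist u v <= J%:R * delta.
  move=> vs; rewrite -ler_pdivrMr //; apply: le_trans (ltW (truncnS_gt _)) _.
  by rewrite ler_nat /J (big_rem v) //= leq_maxl.
pose a (j : nat) := (2 ^+ (j + 4) * delta) ^+ 2 * ((1 + 4 ^+ (j + 3) * x0) ^+ (4 * r))^-1.
have base0 (j : nat) : 0 < 1 + 4 ^+ (j + 3) * x0.
  by rewrite addr_gt0 // mulr_gt0 // exprn_gt0.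
have a0 j : 0 <= a j.
  by rewrite mulr_ge0 ?sqr_ge0 // invr_ge0 exprn_ge0 // ltW.
pose inball j := [pred v | edist v u <= 2 ^+ (j + 4) * delta].
apply: (@le_trans _ _ (\sum_(v <- s) \sum_(j < J) (inball j v)%:R * a j)).
  rewrite big_mkcond big_seq [leRHS]big_seq; apply: ler_sum => v vs.
  have t0 (j : 'I_J) : 0 <= (inball j v)%:R * a j by rewrite mulr_ge0.
  case: ifP => [far|_]; last by apply: sumr_ge0.
  have [j jJ /andP[lo hi]] := dyadic_shell d0 far (JP v vs).
  have hb : edist v u <= 2 ^+ (j + 4) * delta by rewrite edistC.
  rewrite (bigD1 (Ordinal jJ)) //= hb mul1r.
  apply: (@le_trans _ _ (a j)); last first.
    by rewrite lerDl; apply: sumr_ge0 => i _; exact: t0.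
  have b0 : 0 <= 1 + edist u v ^+ 2 / sigma ^+ 2.
    by apply: addr_ge0 => //; apply: divr_ge0; exact: sqr_ge0.
  rewrite /a; apply: ler_pM; [exact: sqr_ge0|by rewrite invr_ge0; exact: exprn_ge0| | ].
  - by rewrite lerXn2r ?nnegrE ?edist_ge0 // mulr_ge0 ?exprn_ge0 // ltW.
  - have le : 1 + 4 ^+ (j + 3) * x0 <= 1 + edist u v ^+ 2 / sigma ^+ 2.
      rewrite lerD2l /x0 mulrA ler_pM2r ?invr_gt0 ?exprn_gt0 //.
      rewrite (_ : 4 ^+ _ * _ = (2 ^+ (j + 3) * delta) ^+ 2).
        by rewrite lerXn2r ?nnegrE ?edist_ge0 ?(ltW lo) // mulr_ge0 ?exprn_ge0 // ltW.
      by rewrite exprMn -exprM mulnC exprM; congr (_ ^+ _ * _); ring.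
    have q1 := base0 j; have q2 := lt_le_trans q1 le.
    by rewrite lef_pV2 ?posrE ?exprn_gt0 // lerXn2r // nnegrE ltW.
rewrite exchange_big /=.
apply: (@le_trans _ _ (\sum_(j < J) 4 * delta ^+ 2 * (4 ^+ (j + 3))^-1)); last first.
  rewrite -mulr_sumr; have := geometric_shells (R := R) J.
  have : 0 < delta ^+ 2 by rewrite exprn_gt0.
  by move: (\sum_(_ < _) _) => S; nra.
apply: ler_sum => j _; rewrite -mulr_suml.
have cnt : \sum_(v <- s) (inball j v)%:R <= expR H ^+ (j + 5).
  have pf : packing delta (cball u (2 ^+ (j + 4) * delta) `&` K) (seq.filter (inball j) s).
    by apply: (packing_filter ps) => v bv Kv; split.
  have := packing_ball_count (c := 2) (lexx _) d0 hloc Ku pf.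
  rewrite (_ : (j + 4).+1 = j + 5)%N ?addnS //; apply: le_trans.
  rewrite size_filter -sum1_count natr_sum [leRHS]big_mkcond /=.
  by apply: ler_sum => v _; case: (edist v u <= _).
apply: (le_trans (ler_wpM2r (a0 j) cnt)).
have l2 : (2 <= j + 3)%N by rewrite addn3.
have := shell_term_le x00 H0 Hr rx l2.
rewrite -addnA /= /a => h.
rewrite (_ : (2 ^+ (j + 4) * delta) ^+ 2 = 4 * delta ^+ 2 * 4 ^+ (j + 3)).
  have d2 : 0 <= 4 * delta ^+ 2 by rewrite mulr_ge0 ?sqr_ge0.
  have := ler_wpM2l d2 h; apply: le_trans.
  by rewrite le_eqVlt; apply/orP; left; apply/eqP; rewrite !mulrA; ring.
rewrite exprMn -exprM mulnC exprM (_ : 2 ^+ 2 = 4); last by ring.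
by rewrite (_ : j + 4 = (j + 3).+1)%N ?addnS // exprS; ring.
Qed.

End UpperBound.

(** * Upper bounds on the minimax risk *)

Section MinimaxUpper.
Context {R : realType} {n N : nat}.
Implicit Types (K : set (n.-tuple R)) (k x : n.-tuple R) (delta sigma eps H : R).

Lemma edist_le_enorm x k : edist x k <= enorm x + enorm k.
Proof.
have e0 x' : enorm x' = edist x' (nseq_tuple n 0).
  by rewrite /edist /enorm; congr Num.sqrt; apply: eq_bigr => i _;
    rewrite tnth_mktuple tnth_nseq subr0.
by rewrite !e0 (edistC k); exact: edist_triangle.
Qed.

Lemma minimax_risk_le K sigma eps (muhat : N.-tuple (n.-tuple R) -> n.-tuple R) (b : R) :
  measurable_fun [set: N.-tuple (n.-tuple R)] muhat ->
  (forall mu d (Omega : measurableType d) (P : probability Omega R)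
     (xi : 'I_N -> Omega -> n.-tuple R) C, K mu -> noise_model P xi sigma ->
     adversary eps C ->
     (\int[P]_w (edist (muhat (C (sample mu xi w))) mu ^+ 2)%:E <= b%:E)%E) ->
  (minimax_risk N K sigma eps <= b%:E)%E.
Proof.
move=> mm h; apply: (@le_trans _ _ (worst_risk K sigma eps muhat)).
  by apply: ereal_inf_lbound; exists muhat.
apply: ge_ereal_sup => _ [mu [Kmu [d [T [P [xi [C [nm [adv ->]]]]]]]]].
exact: h.
Qed.

Lemma minimax_risk_le_sqr_radius K sigma eps k (D : R) : 0 <= D ->
  (forall x, K x -> edist k x <= D) ->
  (minimax_risk N K sigma eps <= (D ^+ 2)%:E)%E.
Proof.
move=> D0 hD; apply: (minimax_risk_le (muhat := fun _ => k)) => //.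
move=> mu d Omega P xi C Kmu _ _ /=.
rewrite integral_cst // [X in (_ * X)%E]probability_setT mule1 lee_fin.
by rewrite lerXn2r ?nnegrE ?edist_ge0 //; exact: hD.
Qed.

Lemma minimax_risk_tournament K k delta sigma eps H (r : nat) :
  bounded_euclid K -> star_center K k -> 0 < delta -> 0 < sigma -> eps <= 32^-1 ->
  (forall i : nat, (local_packing K (2 ^+ i * delta) 2 <= (expR H)%:E)%E) ->
  0 <= H -> H <= r%:R * Num.min (delta ^+ 2 / sigma ^+ 2) 1 / 2 ->
  1 <= r%:R * (delta ^+ 2 / sigma ^+ 2) ->
  2 ^+ 36 * eps * sigma ^+ 2 <= delta ^+ 2 ->
  4 * r%:R * 2 ^+ 32 <= N%:R :> R ->
  (minimax_risk N K sigma eps <= (132 * delta ^+ 2)%:E)%E.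
Proof.
move=> [rho hrho] [Kk _] d0 s0 e32 hloc H0 Hr rx heps hN.
have Kball x : K x -> edist x k <= 2 * rho.
  move=> Kx; apply: le_trans (edist_le_enorm x k) _.
  by have := hrho _ Kx; have := hrho _ Kk; lra.
pose j := Num.truncn (2 * rho / delta).
have hj x : K x -> edist x k <= 2 ^+ j.+1 * delta.
  move=> /Kball /le_trans; apply; rewrite -ler_pdivrMr //.
  apply: le_trans (ltW (truncnS_gt _)) _.
  by rewrite -natrX ler_nat ltnW // ltn_expl.
(* This bound only makes a maximal packing exist; it does not enter the risk. *)
have hsize s : packing delta K s -> (size s)%:R <= expR H ^+ j.+2.
  move=> ps; apply: (packing_ball_count (c := 2) (lexx _) d0 hloc Kk (j := j.+1)).
  by case: ps => sK ps; split=> // x xs; split; [apply: hj|]; exact: sK.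
have [G [pG cG]] := maximal_packing hsize.
have [g0 g0G _] := cG _ Kk.
have i0 : 'I_(size G) by exists 0%N; case: (G) g0G.
pose g := tnth (in_tuple G).
have gG i : g i \in G by exact: mem_tnth.
have uG : uniq G by apply: packing_uniq pG; exact: ltW.
have g_sep i i' : i != i' -> 0 < edist (g i) (g i').
  move=> ii'; apply: (lt_trans d0); apply: (packing_separated (ltW d0) pG) => //.
  apply: contra ii' => /eqP; rewrite /g !(tnth_nth g0) /= => gg.
  by rewrite -val_eqE /= -(nth_uniq g0 (ltn_ord i) (ltn_ord i') uG) gg.
apply: (minimax_risk_le (muhat := tournament g i0 sigma)).
  exact: measurable_tournament.
move=> mu d Omega P xi C Kmu nm adv.
have [u uG' muu] := cG _ Kmu.
have [i1 gk0] : exists i1, g i1 = u.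
  by have /tnthP[i1 ->] : u \in in_tuple G by []; exists i1.
rewrite -gk0 in muu.
apply: le_trans (tournament_risk i0 g_sep nm adv s0 e32 (ltW d0) muu heps hN) _.
rewrite lee_fin (_ : \sum_(j0 | _) _ = \sum_(v <- G | 8 * delta < edist (g i1) v)
   edist (g i1) v ^+ 2 * ((1 + edist (g i1) v ^+ 2 / sigma ^+ 2) ^+ (4 * r))^-1); last first.
  by rewrite [RHS]big_tnth.
have Kg : K (g i1) by apply: (proj1 pG).
have := far_sum_le d0 s0 Kg pG hloc H0 Hr rx.
lra.
Qed.

End MinimaxUpper.

(* A probability on a finite type [J], realised on [nat] through an enumeration
   of [J] so as to reuse the discrete sigma-algebra of [nat]. *)
Section FiniteProbability.
Context {R : realType} (J : finType) (j0 : J) (q : J -> R).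
Hypotheses (q_ge0 : forall j, 0 <= q j) (q_sum1 : \sum_j q j = 1).

Definition decode (w : nat) : J := nth j0 (enum J) w.

Definition finite_measure : set nat -> \bar R :=
  msum (fun k => mscale (NngNum (q_ge0 (decode k))) (dirac k)) #|J|.

HB.instance Definition _ := Measure.on finite_measure.

Lemma sum_decode (V : nmodType) (F : J -> V) : \sum_(k < #|J|) F (decode k) = \sum_j F j.
Proof.
rewrite (reindex (@enum_rank J)) /=; last by apply: onW_bij; exact: enum_rank_bij.
by apply: eq_bigr => j _; rewrite /decode nth_enum_rank.
Qed.

Lemma finite_measure_setT : finite_measure [set: nat] = 1%E.
Proof.
rewrite /finite_measure /msum /mscale /=.
under eq_bigr => k _ do rewrite /= /mscale /= diracT mule1.
by rewrite sumEFin (sum_decode q) q_sum1.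
Qed.

Definition finite_probability : probability nat R :=
  HB.pack finite_measure
    (Measure_isProbability.Build _ _ _ finite_measure finite_measure_setT).

Lemma finite_probability_preimage (A : set J) :
  finite_probability (decode @^-1` A) = (\sum_j q j * \1_A j)%:E.
Proof.
rewrite /finite_probability /= /finite_measure /msum /mscale /=.
by under eq_bigr => k _ do rewrite /= /mscale /= diracE -EFinM;
   rewrite sumEFin -(sum_decode (fun j => q j * \1_A j)).
Qed.

Lemma ge0_integral_finite (f : J -> R) : (forall j, 0 <= f j) ->
  (\int[finite_probability]_w (f (decode w))%:E = (\sum_j q j * f j)%:E)%E.
Proof.
move=> f0; rewrite /finite_probability /= /finite_measure.
rewrite ge0_integral_measure_sum //=; last by move=> w _; rewrite lee_fin.
rewrite -(sum_decode (fun j => q j * f j)) -sumEFin; apply: eq_bigr => k _.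
rewrite ge0_integral_mscale //=; last by move=> w _; rewrite lee_fin.
by rewrite integral_dirac // diracT mul1e -EFinM.
Qed.

Lemma finite_Lfun2 (f : J -> R) : f \o decode \in Lfun finite_probability 2%:E.
Proof.
rewrite inE; apply/andP; split; rewrite inE //= /finite_norm unlock poweR_lty //.
under eq_integral => w _ do rewrite /=.
by rewrite (ge0_integral_finite (f := fun j => `|f j| `^ 2)) ?ltry // => j; exact: powR_ge0.
Qed.

Lemma finite_Lfun1 (f : J -> R) : f \o decode \in Lfun finite_probability 1%E.
Proof.
by apply: (Lfun_subset12 _ (finite_Lfun2 f)); exact: fin_num_measure.
Qed.

Lemma finite_expectation (f : J -> R) :
  ('E_(finite_probability)[f \o decode] = (\sum_j q j * f j)%:E)%E.
Proof.
(* The integral formula is for nonnegative functions, so [f] is shifted by a constant dominating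
   [- f]. *)
pose M := \sum_j `|f j|.
have fM j : 0 <= f j + M.
  rewrite -lerBlDl sub0r; apply: (@le_trans _ _ `|f j|).
    by rewrite -normrN ler_norm.
  by rewrite /M (bigD1 j) //= lerDl sumr_ge0.
have -> : f \o decode = ((fun j => f j + M) \o decode) \- cst M.
  by apply/funext => w /=; rewrite addrK.
rewrite expectationB ?expectation_cst; [|exact: finite_Lfun1|exact: Lfun_cst].
rewrite unlock (_ : (\int[_]_w _)%E = (\sum_j q j * (f j + M))%:E); last first.
  exact: ge0_integral_finite fM.
rewrite -EFinB; congr EFin.
under eq_bigr do rewrite mulrDr.
by rewrite big_split /= -mulr_suml q_sum1 mul1r addrK.
Qed.

End FiniteProbability.

(** * Finite product models as instances of the noise model *)

Section ProductModel.
Context {R : realType} {n N : nat} (T : finType) (t0 : T) (q : T -> R).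
Hypotheses (q_ge0 : forall t, 0 <= q t) (q_sum1 : \sum_t q t = 1).

Definition prod_weight (h : {ffun 'I_N -> T}) : R := \prod_i q (h i).

Lemma prod_weight_ge0 h : 0 <= prod_weight h.
Proof. by apply: prodr_ge0. Qed.

Lemma sum_prod_weight (F : 'I_N -> T -> R) :
  \sum_h prod_weight h * \prod_i F i (h i) = \prod_i \sum_t q t * F i t.
Proof.
rewrite bigA_distr_bigA; apply: eq_bigr => h _.
by rewrite /prod_weight -big_split.
Qed.

Lemma prod_weight_sum1 : \sum_h prod_weight h = 1.
Proof.
transitivity (\sum_h prod_weight h * \prod_(i < N) (1 : R)).
  by apply: eq_bigr => h _; rewrite big1 ?mulr1.
rewrite (sum_prod_weight (fun _ _ => 1)) big1 // => i _.
by rewrite -[RHS]q_sum1; apply: eq_bigr => t _; rewrite mulr1.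
Qed.

Lemma sum_prod_weight_coord (f : T -> R) i :
  \sum_h prod_weight h * f (h i) = \sum_t q t * f t.
Proof.
pose F i' t := if i' == i then f t else 1.
transitivity (\sum_h prod_weight h * \prod_(i' < N) F i' (h i')).
  apply: eq_bigr => h _; congr (_ * _).
  by rewrite (bigD1 i) //= /F eqxx big1 ?mulr1 // => i' /negPf ->.
rewrite sum_prod_weight (bigD1 i) //= [X in _ * X]big1 => [|i' /negPf ne].
  by rewrite mulr1; apply: eq_bigr => t _; rewrite /F eqxx.
by rewrite -[RHS]q_sum1; apply: eq_bigr => t _; rewrite /F ne mulr1.
Qed.

Variable y : T -> n.-tuple R.

Local Notation P := (finite_probability [ffun=> t0] prod_weight_ge0 prod_weight_sum1).
Local Notation dec := (decode [ffun=> t0]).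

Definition product_noise (i : 'I_N) (w : nat) : n.-tuple R := y (dec w i).

Lemma product_noise_preimage i (B : set (n.-tuple R)) :
  P (product_noise i @^-1` B) = (\sum_t q t * \1_B (y t))%:E.
Proof.
rewrite (_ : _ @^-1` _ = dec @^-1` [set h | B (y (h i))]) //.
rewrite finite_probability_preimage -(sum_prod_weight_coord (fun t => \1_B (y t)) i).
by congr EFin; apply: eq_bigr => h _; congr (_ * _).
Qed.

Lemma product_noise_model sigma :
  (forall k, \sum_t q t * tnth (y t) k = 0) ->
  (forall u : 'rV[R]_n, \sum_t q t * (\sum_k u 0 k * tnth (y t) k) ^+ 2
     <= sigma ^+ 2 * \sum_k u 0 k ^+ 2) ->
  noise_model P product_noise sigma.
Proof.
move=> mean0 cov.
have coordE i k : coord k \o product_noise i =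
    (fun h : {ffun 'I_N -> T} => tnth (y (h i)) k) \o dec by [].
split; [by []|split; [|split; [|split; [|split]]]].
- by move=> i j B _; rewrite !product_noise_preimage.
- move=> B _; under [RHS]eq_bigr do rewrite product_noise_preimage.
  rewrite prodEFin -(sum_prod_weight (fun i t => \1_(B i) (y t))).
  rewrite (_ : \bigcap_(i in _) _ =
    dec @^-1` (\bigcap_(i in [set: 'I_N]) [set h | B i (y (h i))])) //.
  rewrite finite_probability_preimage; congr EFin; apply: eq_bigr => h _; congr (_ * _).
  rewrite indicE; have [hin|hnin] := boolP (h \in _).
    rewrite big1 // => i _; rewrite indicE mem_set //.
    by move/set_mem: hin => /(_ i I).
  have [i hi] : exists i, ~ B i (y (h i)).
    apply: contrapT => /forallNP allB; move/negP: hnin; apply; apply/mem_set => i _ /=.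
    by apply: contrapT => nB; apply: (allB i).
  by rewrite (bigD1 i) //= indicE memNset // mul0r.
- by move=> i k; rewrite coordE; exact: finite_Lfun2.
- move=> i k; rewrite coordE finite_expectation.
  by rewrite (sum_prod_weight_coord (fun t => tnth (y t) k)) mean0.
- move=> i u; rewrite subr_ge0.
  have covE k l : cov_matrix P (product_noise i) k l = \sum_t q t * (tnth (y t) k * tnth (y t) l).
    rewrite mxE unlock !coordE !finite_expectation.
    rewrite !(sum_prod_weight_coord (fun t => tnth (y t) _)) !mean0 /=.
    rewrite (_ : _ * _ = (fun h : {ffun 'I_N -> T} => tnth (y (h i)) k * tnth (y (h i)) l) \o dec).
      by rewrite finite_expectation (sum_prod_weight_coord (fun t => tnth (y t) k * tnth (y t) l)).
    apply/funext => w; transitivity ((tnth (y (dec w i)) k - 0) * (tnth (y (dec w i)) l - 0)) => //.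
    by rewrite !subr0.
  rewrite mul_mx_scalar -scalemxAl [leRHS]mxE.
  rewrite (_ : (u *m u^T) 0 0 = \sum_k u 0 k ^+ 2); last first.
    by rewrite mxE; apply: eq_bigr => k _; rewrite mxE expr2.
  apply: le_trans (cov u); rewrite le_eqVlt; apply/orP; left; apply/eqP.
  transitivity (\sum_k \sum_l \sum_t q t * (u 0 k * tnth (y t) k * (u 0 l * tnth (y t) l))).
    rewrite mxE exchange_big /=; apply: eq_bigr => l _.
    rewrite [(u *m _) _ _]mxE [u^T _ _]mxE mulr_suml.
    apply: eq_bigr => k _; rewrite covE mulr_sumr mulr_suml.
    by apply: eq_bigr => t _; ring.
  under eq_bigr do rewrite exchange_big /=.
  rewrite exchange_big /=; apply: eq_bigr => t _.
  rewrite expr2 mulr_suml mulr_sumr; apply: eq_bigr => k _.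
  by rewrite mulr_sumr mulr_sumr.
Qed.

(** [worst_risk] ranges over all probability spaces, so each finite product model bounds it from
    below, by a finite sum. *)
Lemma worst_risk_ge_product K sigma eps mu C
    (muhat : N.-tuple (n.-tuple R) -> n.-tuple R) :
  K mu -> noise_model P product_noise sigma -> adversary eps C ->
  ((\sum_h prod_weight h *
     edist (muhat (C [tuple vadd mu (y (h i)) | i < N])) mu ^+ 2)%:E
   <= worst_risk K sigma eps muhat)%E.
Proof.
move=> Kmu nm adv; apply: ereal_sup_ubound.
exists mu; split => //; exists default_measure_display, nat, P, product_noise, C.
split=> //; split=> //.
symmetry; apply: (ge0_integral_finite _ _ _
  (f := fun h : {ffun 'I_N -> T} =>
     edist (muhat (C [tuple vadd mu (y (h i)) | i < N])) mu ^+ 2)) => h.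
exact: sqr_ge0.
Qed.

End ProductModel.

(** * Lower bound from contamination *)

Section Eraser.
Context {R : realType} {n N : nat}.
Implicit Types (a : n.-tuple R) (x : N.-tuple (n.-tuple R)).

Definition outliers a x : R := \sum_(i < N) (tnth x i != a)%:R.

(** [adversary] constrains every sample, not only typical ones, so nothing is changed beyond the
    budget. *)
Definition eraser (eps : R) a x : N.-tuple (n.-tuple R) :=
  if outliers a x <= eps * N%:R then nseq_tuple N a else x.

Lemma measurable_point a : measurable [set a].
Proof.
rewrite (_ : [set a] = \bigcap_(k in [set: 'I_n]) ((fun x : n.-tuple R => tnth x k) @^-1` [set tnth a k])).
  apply: fin_bigcap_measurable => [|k _]; first exact: finite_finset.
  by rewrite -[X in measurable X]setTI; apply: measurable_tnth.
apply/seteqP; split=> x /=; first by move=> -> k _.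
by move=> h; apply: eq_from_tnth => k; exact: h.
Qed.

Lemma eraser_adversary (eps : R) a : 0 <= eps -> adversary eps (eraser eps a).
Proof.
move=> eps0; split.
  pose phi x : {ffun 'I_N -> bool} := [ffun i => tnth x i != a].
  pose F (b : {ffun 'I_N -> bool}) := \sum_(i < N) (b i)%:R <= eps * N%:R.
  have -> : eraser eps a = fun x => if (F \o phi) x then nseq_tuple N a else x.
    apply/funext => x; rewrite /eraser /= /F /outliers.
    by congr (if _ <= _ then _ else _); apply: eq_bigr => i _; rewrite ffunE.
  apply: measurable_fun_ifT => //.
  apply: measurable_fun_finfactor => b.
  rewrite (_ : _ @^-1` _ = \bigcap_(i in [set: 'I_N])
      ((fun x : N.-tuple (n.-tuple R) => tnth x i) @^-1` (if b i then ~` [set a] else [set a]))).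
    apply: fin_bigcap_measurable => [|i _]; first exact: finite_finset.
    rewrite -[X in measurable X]setTI; apply: measurable_tnth => //.
    by case: (b i); [apply: measurableC|]; exact: measurable_point.
  apply/seteqP; split=> x /=.
    by move=> <- i _; rewrite /= ffunE; case: eqP.
  move=> h; apply/ffunP => i; rewrite ffunE; have := h i I.
  by rewrite /=; case: (b i) => /= /eqP; [|move=> ->].
move=> x; rewrite /eraser; case: ifP => [le|_]; last first.
  rewrite (_ : #|_| = 0%N) ?mulr_ge0 //.
  by apply: eq_card0 => i; apply/negP => /set_mem /=; rewrite eqxx.
apply: le_trans le; rewrite /outliers -natr_sum ler_nat -sum1_card big_mkcond /=.
apply: leq_sum => i _; case: ifP => // /set_mem /=.
by rewrite tnth_nseq eq_sym => ->.
Qed.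

Lemma eraser_const (eps : R) a : eraser eps a (nseq_tuple N a) = nseq_tuple N a.
Proof. by rewrite /eraser; case: ifP. Qed.

End Eraser.

Section TwoPoint.
Context {R : realType} {n N : nat}.
Implicit Types (a p : n.-tuple R).

(* Noise-free data at [a] against data at [p] which sit at [a] except for
   outliers of probability [eps / 4]; the eraser makes the two indistinguishable. *)
Lemma worst_risk_two_point (K : set (n.-tuple R)) (sigma eps : R) a p
    (muhat : N.-tuple (n.-tuple R) -> n.-tuple R) :
  (1 <= N)%N -> K a -> K p -> 0 < eps -> eps <= 1 ->
  4 * edist p a ^+ 2 <= eps * sigma ^+ 2 ->
  ((3 / 16 * edist p a ^+ 2)%:E <= worst_risk K sigma eps muhat)%E.
Proof.
move=> N1 Ka Kp e0 e1 hd.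
(* Outliers use a quarter of the budget on average, so by Markov's inequality the eraser succeeds
   with probability at least [3 / 4]. *)
pose pi := eps / 4.
have pi0 : 0 < pi by rewrite /pi; lra.
have pi1 : pi <= 1 by rewrite /pi; lra.
pose q (t : bool) : R := if t then pi else 1 - pi.
have q0 t : 0 <= q t by rewrite /q; case: t; lra.
have sumb (F : bool -> R) : \sum_t F t = F true + F false.
  by rewrite (bigD1 true) //= (bigD1 false) //= big1 ?addr0 // => -[].
have q1 : \sum_t q t = 1 by rewrite sumb /q; lra.
pose v := vsub p a.
have vk k : tnth v k = tnth p k - tnth a k by rewrite tnth_mktuple.
pose y0 (t : bool) : n.-tuple R := nseq_tuple n 0.
(* [p - v = a], so ordinary data sit at [a] and the outlier restores mean zero. The variance along
   [v], of order [1 / pi], is admissible because [|v| ^ 2 <= pi * sigma ^ 2]. *)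
pose y1 (t : bool) : n.-tuple R := if t then vscale (pi^-1 - 1) v else vscale (-1) v.
have y1k t k : tnth (y1 t) k = (if t then pi^-1 - 1 else -1) * tnth v k.
  by rewrite /y1; case: t; rewrite tnth_mktuple.
have mean0 k : \sum_t q t * tnth (y0 t) k = 0.
  by apply: big1 => t _; rewrite tnth_nseq mulr0.
have cov0 (u : 'rV[R]_n) : \sum_t q t * (\sum_k u 0 k * tnth (y0 t) k) ^+ 2
    <= sigma ^+ 2 * \sum_k u 0 k ^+ 2.
  rewrite big1 => [|t _].
    by apply: mulr_ge0; [exact: sqr_ge0|apply: sumr_ge0 => k _; exact: sqr_ge0].
  by rewrite big1 ?expr0n ?mulr0 // => k _; rewrite tnth_nseq mulr0.
have mean1 k : \sum_t q t * tnth (y1 t) k = 0.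
  by rewrite sumb !y1k /q; field; rewrite gt_eqF.
have cov1 (u : 'rV[R]_n) : \sum_t q t * (\sum_k u 0 k * tnth (y1 t) k) ^+ 2
    <= sigma ^+ 2 * \sum_k u 0 k ^+ 2.
  pose uv := \sum_k u 0 k * tnth v k.
  have yE t : \sum_k u 0 k * tnth (y1 t) k = (if t then pi^-1 - 1 else -1) * uv.
    by rewrite /uv mulr_sumr; apply: eq_bigr => k _; rewrite y1k mulrCA.
  rewrite sumb !yE /q.
  have -> : pi * ((pi^-1 - 1) * uv) ^+ 2 + (1 - pi) * (-1 * uv) ^+ 2 =
     (1 - pi) * (uv ^+ 2 / pi) by field; rewrite gt_eqF.
  pose ut := [tuple u 0 k | k < n].
  have uvE : uv = dot ut v by apply: eq_bigr => k _; rewrite [tnth ut _]tnth_mktuple.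
  have uuE : \sum_k u 0 k ^+ 2 = dot ut ut.
    by apply: eq_bigr => k _; rewrite !tnth_mktuple expr2.
  have vvE : dot v v = edist p a ^+ 2 by rewrite -sqr_enorm.
  have := cauchy_schwarz ut v; rewrite -uvE -uuE vvE => cs.
  have uu0 : 0 <= \sum_k u 0 k ^+ 2 by apply: sumr_ge0 => k _; exact: sqr_ge0.
  apply: (@le_trans _ _ (uv ^+ 2 / pi)).
    have : 0 <= uv ^+ 2 / pi by apply: divr_ge0; [exact: sqr_ge0|exact: ltW].
    move: (uv ^+ 2 / pi) => z z0; nra.
  rewrite ler_pdivrMr //; apply: le_trans cs _.
  rewrite [leRHS]mulrAC [leLHS]mulrC ler_wpM2r //.
  by rewrite /pi; lra.
have nm0 := product_noise_model (N := N) true q0 q1 mean0 cov0.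
have nm1 := product_noise_model (N := N) true q0 q1 mean1 cov1.
have adv := eraser_adversary (N := N) a (ltW e0).
pose m := muhat (nseq_tuple N a).
have r0 : ((edist m a ^+ 2)%:E <= worst_risk K sigma eps muhat)%E.
  apply: le_trans (worst_risk_ge_product muhat Ka nm0 adv).
  rewrite lee_fin (eq_bigr (fun h => prod_weight q h * edist m a ^+ 2)); last first.
    move=> h _; rewrite (_ : [tuple _ | i < N] = nseq_tuple N a) ?eraser_const //.
    apply: eq_from_tnth => i; rewrite tnth_mktuple tnth_nseq.
    by apply: eq_from_tnth => k; rewrite tnth_mktuple tnth_nseq addr0.
  by rewrite -mulr_suml prod_weight_sum1 // mul1r.
have r1 : ((3 / 4 * edist m p ^+ 2)%:E <= worst_risk K sigma eps muhat)%E.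
  apply: le_trans (worst_risk_ge_product muhat Kp nm1 adv).
  pose cnt (h : {ffun 'I_N -> bool}) : R := \sum_i (h i)%:R.
  have N0 : 0 < N%:R :> R by rewrite ltr0n.
  have eN : 0 < eps * N%:R by rewrite mulr_gt0.
  have w0 h := prod_weight_ge0 q0 h.
  (* [1 - cnt h / (eps * N)] lies below the indicator of success: Markov's inequality in pointwise
     form. *)
  rewrite lee_fin; apply: (@le_trans _ _ (\sum_h prod_weight q h *
      ((1 - cnt h / (eps * N%:R)) * edist m p ^+ 2))).
    under eq_bigr do rewrite mulrA.
    rewrite -mulr_suml ler_wpM2r ?sqr_ge0 //.
    under eq_bigr do rewrite mulrBr mulr1 mulrA.
    rewrite sumrB prod_weight_sum1 // -mulr_suml.
    have -> : \sum_h prod_weight q h * cnt h = N%:R * pi.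
      under eq_bigr do rewrite mulr_sumr.
      rewrite exchange_big /= (eq_bigr (fun=> pi)) ?sumr_const ?card_ord ?mulr_natl //.
      move=> i _; rewrite (sum_prod_weight_coord q1 (fun t => t%:R)) sumb /q.
      by rewrite mulr1 mulr0 addr0.
    have -> : N%:R * pi / (eps * N%:R) = 1 / 4 by rewrite /pi; field; rewrite !gt_eqF.
    lra.
  apply: ler_sum => h _; rewrite ler_wpM2l //.
  have [good|bad] := leP (cnt h) (eps * N%:R); last first.
    apply: (@le_trans _ _ 0); last exact: sqr_ge0.
    by rewrite mulr_le0_ge0 ?sqr_ge0 // subr_le0 ler_pdivlMr // mul1r ltW.
  set x := [tuple _ | i < N].
  have -> : eraser eps a x = nseq_tuple N a.
    rewrite /eraser (le_trans _ good) //; apply: ler_sum => i _.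
    rewrite /x tnth_mktuple; case E: (h i); first by case: eqP.
    rewrite (_ : vadd p (y1 false) = a) ?eqxx //.
    by apply: eq_from_tnth => k; rewrite tnth_mktuple y1k vk; ring.
  rewrite -/m ler_piMl ?sqr_ge0 // lerBlDr lerDl.
  by rewrite divr_ge0 ?(ltW eN) // sumr_ge0.
(* The single estimate [m] is at least half of [edist p a] away from one of the two means. *)
have tri := edist_triangle m p a; rewrite (edistC p m) in tri.
have [h|h] := leP (edist p a / 2) (edist m a).
  apply: le_trans r0; rewrite lee_fin.
  have : (edist p a / 2) ^+ 2 <= edist m a ^+ 2.
    by rewrite lerXn2r ?nnegrE ?edist_ge0 // divr_ge0 ?edist_ge0.
  have := sqr_ge0 (edist p a); rewrite exprMn exprVn; lra.
apply: le_trans r1; rewrite lee_fin.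
have : (edist p a / 2) ^+ 2 <= edist m p ^+ 2.
  rewrite lerXn2r ?nnegrE ?edist_ge0 //; first by rewrite divr_ge0 ?edist_ge0.
  lra.
rewrite exprMn exprVn; lra.
Qed.

End TwoPoint.

(** * Lower bound from entropy *)

Section SignCube.
Context {R : realType} {n : nat}.
Implicit Types (theta : 'I_n -> R) (t : {ffun 'I_n -> bool}) (b : bool).

Definition sgn b : R := if b then 1 else -1.

(** The law of independent signs with means [theta k]. *)
Definition cube theta t : R := \prod_k ((1 + sgn (t k) * theta k) / 2).

Lemma sum_bool (F : bool -> R) : \sum_b F b = F true + F false.
Proof.
by rewrite (bigD1 true) //= (bigD1 false) //= big1 ?addr0 // => -[].
Qed.

Lemma sum_cube theta (F : 'I_n -> bool -> R) :
  \sum_t cube theta t * \prod_k F k (t k) =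
  \prod_k ((1 + theta k) / 2 * F k true + (1 - theta k) / 2 * F k false).
Proof.
transitivity (\prod_k \sum_b ((1 + sgn b * theta k) / 2 * F k b)); last first.
  by apply: eq_bigr => k _; rewrite sum_bool /sgn mul1r mulN1r.
by rewrite bigA_distr_bigA; apply: eq_bigr => t _; rewrite /cube -big_split.
Qed.

Lemma cube_sum1 theta : \sum_t cube theta t = 1.
Proof.
transitivity (\sum_t cube theta t * \prod_(k < n) (1 : R)).
  by apply: eq_bigr => t _; rewrite big1 ?mulr1.
by rewrite (sum_cube theta (fun _ _ => 1)) big1 // => k _; lra.
Qed.

Lemma cube_ge0 theta t : (forall k, `|theta k| <= 1) -> 0 <= cube theta t.
Proof.
move=> h; apply: prodr_ge0 => k _; have := h k; rewrite ler_norml /sgn.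
by case: (t k) => /andP[h1 h2]; apply: divr_ge0 => //; lra.
Qed.

Lemma sum_cube_coord theta k (f : bool -> R) : \sum_t cube theta t * f (t k) =
  (1 + theta k) / 2 * f true + (1 - theta k) / 2 * f false.
Proof.
pose F k' b := if k' == k then f b else 1.
transitivity (\sum_t cube theta t * \prod_k' F k' (t k')).
  apply: eq_bigr => t _; congr (_ * _).
  by rewrite (bigD1 k) //= /F eqxx big1 ?mulr1 // => k' /negPf ->.
rewrite sum_cube (bigD1 k) //= [X in _ * X]big1 => [|k' /negPf ne].
  by rewrite mulr1 /F eqxx.
by rewrite /F ne; lra.
Qed.

Lemma sum_cube_coord2 theta k l (f g : bool -> R) : k != l ->
  \sum_t cube theta t * (f (t k) * g (t l)) =
  ((1 + theta k) / 2 * f true + (1 - theta k) / 2 * f false) *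
  ((1 + theta l) / 2 * g true + (1 - theta l) / 2 * g false).
Proof.
move=> kl; have lk : l != k by rewrite eq_sym.
pose F k' b := if k' == k then f b else if k' == l then g b else 1.
transitivity (\sum_t cube theta t * \prod_k' F k' (t k')).
  apply: eq_bigr => t _; congr (_ * _).
  rewrite (bigD1 k) //= (bigD1 l) //= /F !eqxx (negPf lk) big1 ?mulr1 //.
  by move=> k' /andP[/negPf -> /negPf ->].
rewrite sum_cube (bigD1 k) //= (bigD1 l) //= [X in _ * (_ * X)]big1.
  by rewrite mulr1 /F !eqxx (negPf lk).
by move=> k' /andP[/negPf n1 /negPf n2]; rewrite /F n1 n2; lra.
Qed.

(** Distinct signs are uncorrelated and each has variance at most [1], so scaling by [sigma] meets
    the covariance constraint for every tilt. *)
Lemma cube_covariance theta (u : 'rV[R]_n) :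
  \sum_t cube theta t * (\sum_k u 0 k * (sgn (t k) - theta k)) ^+ 2 =
  \sum_k u 0 k ^+ 2 * (1 - theta k ^+ 2).
Proof.
pose e k b := u 0 k * (sgn b - theta k).
transitivity (\sum_k \sum_l \sum_t cube theta t * (e k (t k) * e l (t l))).
  symmetry; under eq_bigr do rewrite exchange_big /=.
  rewrite exchange_big /=; apply: eq_bigr => t _.
  rewrite expr2 mulr_suml mulr_sumr; apply: eq_bigr => k _.
  by rewrite !mulr_sumr.
apply: eq_bigr => k _; rewrite (bigD1 k) //= [X in _ + X]big1 => [|l lk]; last first.
  by rewrite (sum_cube_coord2 _ (e k) (e l)) 1?eq_sym // /e /sgn; lra.
by rewrite (sum_cube_coord _ k (fun b => e k b * e k b)) addr0 /e /sgn; field.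
Qed.

(* The left-hand side is one plus the chi-square divergence from the uniform cube. *)
Lemma cube_second_moment theta : \sum_t 2 ^+ n * cube theta t ^+ 2 <=
  expR (\sum_k theta k ^+ 2).
Proof.
have -> : \sum_t 2 ^+ n * cube theta t ^+ 2 = \prod_(k < n) (1 + theta k ^+ 2).
  transitivity (\prod_k \sum_b 2 * ((1 + sgn b * theta k) / 2) ^+ 2); last first.
    by apply: eq_bigr => k _; rewrite sum_bool /sgn; lra.
  rewrite bigA_distr_bigA; apply: eq_bigr => t _.
  rewrite big_split /= prodr_const card_ord; congr (_ * _).
  by rewrite /cube -prodrXl.
rewrite expR_sum; apply: ler_prod => k _.
by rewrite expR_ge1Dx andbT addr_ge0 // sqr_ge0.
Qed.

End SignCube.

Section Fano.
Context {R : realType} {n N : nat}.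
Implicit Types (nu x : n.-tuple R) (s : seq (n.-tuple R)).

(** Serves to say that an estimate is close to at most one point of a packing. *)
Lemma sum_pairwise_le1 (T : Type) (r : T -> T -> bool) (p : pred T) (s : seq T) :
  pairwise r s -> (forall x y : T, p x -> p y -> ~~ r x y) -> \sum_(x <- s) (p x)%:R <= 1 :> R.
Proof.
move=> + h; elim: s => [|x s IH]; first by rewrite big_nil.
rewrite /= => /andP[rx rs]; rewrite big_cons.
have [px|npx] := boolP (p x); last by rewrite add0r; exact: IH.
suff -> : \sum_(y <- s) (p y)%:R = 0 :> R by rewrite addr0.
elim: s rx {IH rs} => [|y s IH] /=; first by rewrite big_nil.
move=> /andP[rxy rxs]; rewrite big_cons IH // addr0.
by have [py|//] := boolP (p y); have := h x y px py; rewrite rxy.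
Qed.

(** The means of the signs for which [nu + sigma * sign] has mean [x]. *)
Definition tilt (sigma : R) nu x (k : 'I_n) : R := (tnth x k - tnth nu k) / sigma.

(* The sample is [nu + sigma * sign] whatever the mean [x]: only the law of the
   signs depends on [x], so that all hypotheses share a finite sample space. *)
Definition sign_noise (sigma : R) nu x (t : {ffun 'I_n -> bool}) : n.-tuple R :=
  [tuple sigma * (sgn (t k) - tilt sigma nu x k) | k < n].

Lemma sum_sqr_tilt sigma nu x : sigma != 0 ->
  \sum_k tilt sigma nu x k ^+ 2 = edist x nu ^+ 2 / sigma ^+ 2.
Proof.
move=> s0; rewrite sqr_edist mulr_suml; apply: eq_bigr => k _.
by rewrite /tilt exprMn exprVn.
Qed.

Lemma tilt_le1 (sigma : R) nu x k : 0 < sigma -> edist x nu <= sigma -> `|tilt sigma nu x k| <= 1.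
Proof.
move=> s0 h; rewrite -(ler_pXn2r (n := 2)) ?nnegrE // expr1n real_normK ?num_real //.
apply: (@le_trans _ _ (\sum_k tilt sigma nu x k ^+ 2)).
  by rewrite (bigD1 k) //= lerDl sumr_ge0 // => l _; exact: sqr_ge0.
rewrite sum_sqr_tilt ?gt_eqF // ler_pdivrMr ?exprn_gt0 // mul1r.
by rewrite lerXn2r ?nnegrE ?edist_ge0 // ltW.
Qed.

(** The success probabilities of the [m] hypotheses sum to at most [sqrt (m * V)], with [V] the
    bound on the second moment of the likelihood ratio. Since [V ^ 2 <= m], the average failure is
    at least [3 / 20], and a failure costs [(eta / 2) ^ 2]; [3 / 80] exceeds [3 / 100]. *)
Lemma worst_risk_fano (K : set (n.-tuple R)) (sigma eps tau eta : R) nu s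
    (muhat : N.-tuple (n.-tuple R) -> n.-tuple R) :
  0 < sigma -> 0 <= eps -> tau <= sigma -> 0 < eta ->
  packing eta (cball nu tau `&` K) s -> (2 <= size s)%N ->
  expR (N%:R * (tau ^+ 2 / sigma ^+ 2)) ^+ 2 <= (size s)%:R ->
  ((3 / 100 * eta ^+ 2)%:E <= worst_risk K sigma eps muhat)%E.
Proof.
move=> s0 e0 ts eta0 [sA ps] m2 hV.
set m : R := (size s)%:R in hV; set V := expR _ in hV.
have m2R : 2 <= m by rewrite ler_nat.
have V0 : 0 < V by exact: expR_gt0.
rewrite leNgt; apply/negP => hlt.
pose obs (h : {ffun 'I_N -> {ffun 'I_n -> bool}}) : N.-tuple (n.-tuple R) :=
  [tuple [tuple tnth nu k + sigma * sgn (h i k) | k < n] | i < N].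
pose q x := cube (tilt sigma nu x).
pose W x (h : {ffun 'I_N -> {ffun 'I_n -> bool}}) := prod_weight (q x) h.
pose risk x := \sum_h W x h * edist (muhat (obs h)) x ^+ 2.
have tilt1 x k : x \in s -> `|tilt sigma nu x k| <= 1.
  by move=> /sA[xb _]; apply: tilt_le1 => //; exact: le_trans xb ts.
have q_ge0 x t : x \in s -> 0 <= q x t.
  by move=> xs; apply: cube_ge0 => k; exact: tilt1.
have W_ge0 x h : x \in s -> 0 <= W x h.
  by move=> xs; apply: prod_weight_ge0 => t; exact: q_ge0.
have W_sum1 x : \sum_h W x h = 1.
  by apply: prod_weight_sum1; exact: cube_sum1.
have risk_lt x : x \in s -> risk x < 3 / 100 * eta ^+ 2.
  move=> xs; rewrite -lte_fin; apply: le_lt_trans hlt.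
  have [_ Kx] := sA x xs.
  have mean k : \sum_t q x t * tnth (sign_noise sigma nu x t) k = 0.
    under eq_bigr do rewrite tnth_mktuple.
    rewrite (sum_cube_coord _ k (fun b => sigma * (sgn b - tilt sigma nu x k))) /sgn.
    by lra.
  have cov (u : 'rV[R]_n) : \sum_t q x t * (\sum_k u 0 k * tnth (sign_noise sigma nu x t) k) ^+ 2
      <= sigma ^+ 2 * \sum_k u 0 k ^+ 2.
    have -> : \sum_t q x t * (\sum_k u 0 k * tnth (sign_noise sigma nu x t) k) ^+ 2 =
       sigma ^+ 2 * \sum_t q x t * (\sum_k u 0 k * (sgn (t k) - tilt sigma nu x k)) ^+ 2.
      rewrite mulr_sumr; apply: eq_bigr => t _; rewrite [RHS]mulrCA; congr (_ * _).
      rewrite -exprMn mulr_sumr; congr (_ ^+ _); apply: eq_bigr => k _.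
      by rewrite tnth_mktuple mulrCA.
    rewrite cube_covariance ler_wpM2l ?sqr_ge0 //; apply: ler_sum => k _.
    by rewrite ler_piMr ?sqr_ge0 // lerBlDr lerDl sqr_ge0.
  have nm := product_noise_model (N := N) [ffun=> true] (fun t => q_ge0 x t xs)
     (cube_sum1 _) mean cov.
  have adv : adversary (n := n) (N := N) eps id.
    split; first exact: measurable_id.
    move=> X; rewrite (_ : #|_| = 0%N) ?mulr_ge0 //.
    by apply: eq_card0 => i; apply/negP => /set_mem /=; rewrite eqxx.
  apply: le_trans (worst_risk_ge_product muhat Kx nm adv).
  rewrite lee_fin /risk le_eqVlt; apply/orP; left; apply/eqP.
  apply: eq_bigr => h _; congr (_ * edist (muhat _) _ ^+ 2).
  apply: eq_from_tnth => i; apply: eq_from_tnth => k.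
  by rewrite !tnth_mktuple /tilt; field; rewrite gt_eqF.
pose close x h := edist (muhat (obs h)) x < eta / 2.
have close_le1 h : \sum_(x <- s) (close x h)%:R <= 1 :> R.
  apply: (sum_pairwise_le1 ps) => x y; rewrite /close => hx hy.
  rewrite -leNgt; apply: le_trans (edist_triangle (muhat (obs h)) x y) _.
  by rewrite (edistC x); lra.
(* The number of samples: [c0 * W x h] is the density of hypothesis [x] with respect to the uniform
   law. *)
pose c0 : R := (2 ^+ n) ^+ N.
have c00 : 0 < c0 by rewrite !exprn_gt0.
have card0 : \sum_(h : {ffun 'I_N -> {ffun 'I_n -> bool}}) (1 : R) = c0.
  by rewrite sumr_const card_ffun !card_ord card_ffun card_ord card_bool natrX natrX.
have second x : x \in s -> \sum_h c0 * W x h ^+ 2 <= V.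
  move=> xs.
  have -> : \sum_h c0 * W x h ^+ 2 = \prod_(i < N) \sum_t 2 ^+ n * q x t ^+ 2.
    rewrite bigA_distr_bigA; apply: eq_bigr => h _.
    by rewrite big_split /= prodr_const card_ord prodrXl.
  rewrite /V [N%:R * _]mulrC -mulr_natr mulr_natr expRM_natr.
  rewrite -[X in _ <= _ ^+ X]card_ord -prodr_const; apply: ler_prod => i _.
  apply/andP; split; first by apply: sumr_ge0 => t _; rewrite mulr_ge0 ?sqr_ge0 // exprn_ge0.
  apply: le_trans (cube_second_moment _) _.
  rewrite ler_expR sum_sqr_tilt ?gt_eqF // ler_pM2r ?invr_gt0 ?exprn_gt0 //.
  by rewrite lerXn2r ?nnegrE ?edist_ge0 //; [apply: le_trans (proj1 (sA x xs)); exact: edist_ge0|exact: (proj1 (sA x xs))].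
pose z := Num.sqrt (m * V).
have z0 : 0 < z by rewrite sqrtr_gt0 mulr_gt0 //; lra.
have z2 : z ^+ 2 = m * V by rewrite sqr_sqrtr // mulr_ge0 ?ltW //; lra.
(* Pointwise, [w <= c0 * w ^ 2 / (2 * z) + z / (2 * c0)], the second term being paid only when [x]
   is close, that is for at most one [x] per sample. [z] balances the two sums at [z / 2]. *)
have success : \sum_(x <- s) \sum_h W x h * (close x h)%:R <= z.
  apply: (@le_trans _ _ (\sum_(x <- s) \sum_h
      ((c0 * W x h ^+ 2) / (2 * z) + (close x h)%:R * (z / (2 * c0))))).
    apply: ler_sum => x _; apply: ler_sum => h _.
    move: (W x h) => w; case: (close x h) => /=; last first.
      rewrite mulr0 mul0r addr0; apply: divr_ge0; last by rewrite mulr_ge0 // ltW.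
      by rewrite mulr_ge0 ?sqr_ge0 // ltW.
    rewrite mulr1 mul1r -subr_ge0.
    have -> : c0 * w ^+ 2 / (2 * z) + z / (2 * c0) - w = (c0 * w - z) ^+ 2 / (2 * z * c0).
      by field; rewrite !gt_eqF.
    by apply: divr_ge0; [exact: sqr_ge0|rewrite !mulr_ge0 // ltW].
  have -> : \sum_(x <- s) \sum_h
      ((c0 * W x h ^+ 2) / (2 * z) + (close x h)%:R * (z / (2 * c0))) =
    (\sum_(x <- s) \sum_h c0 * W x h ^+ 2) / (2 * z)
    + (\sum_h \sum_(x <- s) (close x h)%:R) * (z / (2 * c0)).
    rewrite [X in _ = _ + X * _]exchange_big !mulr_suml -big_split /=.
    by apply: eq_bigr => x _; rewrite !mulr_suml -big_split.
  have h1 : \sum_(x <- s) \sum_h c0 * W x h ^+ 2 <= m * V.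
    apply: (@le_trans _ _ (\sum_(x <- s) V)).
      by rewrite big_seq [leRHS]big_seq; apply: ler_sum => x xs; exact: second.
    by rewrite big_const_seq count_predT iter_addr_0 -mulr_natl.
  have h2 : \sum_h \sum_(x <- s) (close x h)%:R <= c0.
    by rewrite -card0; apply: ler_sum => h _.
  have i0 : 0 < (2 * z)^-1 by rewrite invr_gt0 mulr_gt0.
  have i1 : 0 < z / (2 * c0) by rewrite divr_gt0 // mulr_gt0.
  have := ler_wpM2r (ltW i0) h1; have := ler_wpM2r (ltW i1) h2.
  have -> : c0 * (z / (2 * c0)) = z / 2 by field; rewrite gt_eqF.
  have -> : m * V / (2 * z) = z / 2 by rewrite -z2; field; rewrite gt_eqF.
  lra.
(* [V / m <= 1 / sqrt m <= 1 / sqrt 2 < (17 / 20) ^ 2]. *)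
have zm : z <= 17 / 20 * m.
  rewrite -(ler_pXn2r (n := 2)) ?nnegrE ?(ltW z0) //; last by lra.
  rewrite z2 exprMn; nra.
have risk_ge x : x \in s -> (eta / 2) ^+ 2 * (1 - \sum_h W x h * (close x h)%:R) <= risk x.
  move=> xs; rewrite -[X in X - _](W_sum1 x) -sumrB mulr_sumr; apply: ler_sum => h _.
  rewrite -{1}[W x h]mulr1 -mulrBr mulrCA ler_wpM2l ?W_ge0 //.
  rewrite /close; case: ltP => [_|far]; first by rewrite subrr mulr0 sqr_ge0.
  by rewrite subr0 mulr1 lerXn2r ?nnegrE ?edist_ge0 // divr_ge0 // ltW.
have total_ge : (eta / 2) ^+ 2 * (m - z) <= \sum_(x <- s) risk x.
  apply: (@le_trans _ _ (\sum_(x <- s) (eta / 2) ^+ 2 * (1 - \sum_h W x h * (close x h)%:R))).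
    rewrite -mulr_sumr ler_wpM2l ?sqr_ge0 // sumrB big_const_seq count_predT iter_addr_0.
    by rewrite lerB.
  by rewrite big_seq [leRHS]big_seq; apply: ler_sum => x xs; exact: risk_ge.
have total_le : \sum_(x <- s) risk x <= m * (3 / 100 * eta ^+ 2).
  apply: (@le_trans _ _ (\sum_(x <- s) (3 / 100 * eta ^+ 2))).
    by rewrite big_seq [leRHS]big_seq; apply: ler_sum => x xs; exact: ltW (risk_lt x xs).
  by rewrite big_const_seq count_predT iter_addr_0 -[leLHS]mulr_natl.
have e2 : 0 < eta ^+ 2 by rewrite exprn_gt0.
have : (eta / 2) ^+ 2 * (3 / 20 * m) <= (eta / 2) ^+ 2 * (m - z).
  by rewrite ler_wpM2l ?sqr_ge0 //; lra.
have me : 0 < m * eta ^+ 2 by rewrite mulr_gt0 //; lra.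
rewrite exprMn exprVn; lra.
Qed.

End Fano.

Section ExtendedLog.
Context {R : realType}.
Implicit Types (x : \bar R) (a y : R).

Lemma elog_le x a : (elog x <= a%:E)%E -> (x <= (expR a)%:E)%E.
Proof.
case: x => [r| |] /=; rewrite ?leNye ?leye_eq //; rewrite !lee_fin => h.
have [r0|r0] := leP r 0; first by apply: le_trans r0 _; exact: expR_ge0.
by rewrite -[leLHS]lnK ?posrE // ler_expR.
Qed.

(** Positivity of [y] excludes nonpositive [x], where [ln] has the default value [0]. *)
Lemma le_elog x y : 0 < y -> (y%:E <= elog x)%E -> ((expR y)%:E <= x)%E.
Proof.
move=> y0; case: x => [r| |] /=; rewrite ?leey ?leeNy_eq //; rewrite !lee_fin => h.
have [r0|r0] := leP r 0; first by move: h; rewrite ln0 // leNgt y0.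
by rewrite -[leRHS]lnK ?posrE // ler_expR.
Qed.

Lemma elog_ge1 x : (1 <= x)%E -> (0 <= elog x)%E.
Proof. by case: x => [r| |] //=; rewrite !lee_fin; exact: ln_ge0. Qed.

End ExtendedLog.

Section Geometry.
Context {R : realType} {n : nat}.
Implicit Types (K : set (n.-tuple R)) (k x : n.-tuple R).

(** The diameter need not be attained: when it is positive, a pair more than [2 / 3 * d] apart is
    taken, and one of its points is at least [d / 3] from [k]. *)
Lemma diameter_real K k : bounded_euclid K -> K k -> exists d : R,
  [/\ diameter K = d%:E, 0 <= d, (forall x y, K x -> K y -> edist x y <= d) &
      exists2 x, K x & d / 3 <= edist x k].
Proof.
move=> [rho hrho] Kk.
have ub x y : K x -> K y -> edist x y <= 2 * rho.
  move=> Kx Ky; apply: le_trans (edist_le_enorm x y) _.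
  by have := hrho _ Kx; have := hrho _ Ky; lra.
have le_diam x y : K x -> K y -> ((edist x y)%:E <= diameter K)%E.
  by move=> Kx Ky; apply: ereal_sup_ubound; exists x => //; exists y.
have diam_le : (diameter K <= (2 * rho)%:E)%E.
  by apply: ge_ereal_sup => _ [x Kx [y Ky <-]]; rewrite lee_fin; exact: ub.
have diam0 : (0 <= diameter K)%E by have := le_diam k k Kk Kk; rewrite edistxx.
case E : (diameter K) diam_le le_diam diam0 => [d| |] //; rewrite ?leye_eq // => _ le_diam.
rewrite lee_fin => d0; exists d; split=> //.
have [dle|dgt] := leP d 0.
  by exists k => //; rewrite edistxx; lra.
have : ((2 / 3 * d)%:E < diameter K)%E by rewrite E lte_fin; lra.
move=> /ereal_sup_gt[_ [x Kx [y Ky <-]]]; rewrite lte_fin => h.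
have := edist_triangle k x y; rewrite (edistC k y) => tri.
have [hx|hx] := leP (d / 3) (edist x k); first by exists x.
by exists y => //; lra.
Qed.

Lemma star_segment K k x (rho : R) : star_center K k -> K x -> 0 <= rho <= edist x k ->
  exists2 p, K p & edist p k = rho.
Proof.
move=> [Kk starK] Kx /andP[r0 rx].
have [e0|e0] := eqVneq (edist x k) 0.
  by exists k => //; rewrite edistxx; lra.
have egt : 0 < edist x k by rewrite lt_def e0 edist_ge0.
have t01 : 0 <= rho / edist x k <= 1 by rewrite divr_ge0 ?edist_ge0 //= ler_pdivrMr // mul1r.
exists (homothety k (rho / edist x k) x); first exact: starK.
by rewrite edist_homothety_center ?divfK //; case/andP: t01.
Qed.

Lemma local_packing_ge2 K k x (delta : R) : star_center K k -> K x ->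
  0 < delta <= edist x k -> (2%:E <= local_packing K delta 2)%E.
Proof.
move=> sk Kx /andP[d0 dx].
have [p Kp pk] : exists2 p, K p & edist p k = delta.
  by apply: star_segment Kx _ => //; rewrite ltW.
apply: (local_packing_ge (nu := k) (s := [:: k; p])); first by case: sk.
split.
  move=> z; rewrite !inE => /orP[/eqP->|/eqP->]; split=> //; rewrite /cball /=.
  - by rewrite edistxx ltW.
  - by case: sk.
  - by rewrite pk.
by rewrite /= !andbT edistC pk; lra.
Qed.

End Geometry.

(** * Both bounds in terms of the critical radius *)

Section Assembly.
Context {R : realType} {n N : nat} (K : set (n.-tuple R)) (k : n.-tuple R).
Variables (sigma eps : R).
Hypotheses (bK : bounded_euclid K) (sK : star_center K k) (N1 : (1 <= N)%N).
Hypotheses (s0 : 0 < sigma) (eps0 : 0 < eps) (eps32 : eps < 32^-1).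
Hypothesis entropy : ((2 ^+ 36)%:E * sup_local_entropy K 2 <= (N%:R)%:E)%E.

Let feasible (delta : R) : Prop := 0 <= delta /\
  ((N%:R * delta ^+ 2 / sigma ^+ 2)%:E <= elog (local_packing K delta 2))%E.

Lemma elog_local_packing_le (delta : R) : 0 < delta ->
  (elog (local_packing K delta 2) <= (N%:R / 2 ^+ 36)%:E)%E.
Proof.
move=> d0; have p0 : 0 < 2 ^+ 36 :> R by rewrite exprn_gt0.
have : ((2 ^+ 36)%:E * elog (local_packing K delta 2) <= (N%:R)%:E)%E.
  apply: le_trans entropy; rewrite lee_wpmul2l ?lee_fin ?(ltW p0) //.
  by apply: ereal_sup_ubound; exists delta.
case: (elog _) => [r| |]; last by rewrite leNye.
  by rewrite -EFinM !lee_fin ler_pdivlMr // mulrC.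
by rewrite gt0_muley ?lte_fin.
Qed.

(** Makes [delta_star] finite and the tilted signs admissible. *)
Lemma feasible_le_sigma delta : feasible delta -> delta <= sigma.
Proof.
move=> [d0 h]; have [->|dn0] := eqVneq delta 0; first exact: ltW.
have dgt : 0 < delta by rewrite lt_def dn0.
have := le_trans h (elog_local_packing_le dgt); rewrite lee_fin.
have N0 : 0 < N%:R :> R by rewrite ltr0n.
rewrite -mulrA ler_pM2l // => h2.
rewrite -(ler_pXn2r (n := 2)) ?nnegrE ?(ltW s0) //.
have S20 : 0 < sigma ^+ 2 by rewrite exprn_gt0.
rewrite -[leRHS]mul1r -ler_pdivrMr //; apply: le_trans h2 _.
by rewrite invf_le1 ?exprn_gt0 // exprn_ege1 // ler1n.
Qed.

Lemma feasible0 : feasible 0.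
Proof.
split=> //; rewrite expr0n mulr0 mul0r; apply: elog_ge1.
by apply: local_packing_ge1 => //; exists k; case: sK.
Qed.

Lemma delta_star_real : exists D : R, [/\ delta_star K N sigma 2 = D%:E, 0 <= D,
  (forall delta, feasible delta -> delta <= D) &
  (forall y, y < D -> exists2 delta, feasible delta & y < delta)].
Proof.
have le_ds delta : feasible delta -> (delta%:E <= delta_star K N sigma 2)%E.
  by move=> fd; apply: ereal_sup_ubound; exists delta.
have ds_le : (delta_star K N sigma 2 <= sigma%:E)%E.
  by apply: ge_ereal_sup => _ [delta fd <-]; rewrite lee_fin; exact: feasible_le_sigma.
have ds0 := le_ds 0 feasible0.
case E : (delta_star K N sigma 2) ds_le le_ds ds0 => [D| |] //; rewrite ?leye_eq // => _ le_ds.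
rewrite lee_fin => D0; exists D; split=> //.
move=> y yD; have : (y%:E < delta_star K N sigma 2)%E by rewrite E lte_fin.
by move=> /ereal_sup_gt[_ [delta fd <-]]; rewrite lte_fin; exists delta.
Qed.

(** Halving by the homothety keeps the cardinality and brings twice the divergence,
    [2 * N * (delta / 2) ^ 2 / sigma ^ 2], down to half of the available entropy. The resulting
    slack yields an actual packing though the supremum may not be attained. *)
Lemma worst_risk_ge_feasible delta (muhat : N.-tuple (n.-tuple R) -> n.-tuple R) :
  0 < delta -> feasible delta ->
  ((3 / 40 ^+ 2 * delta ^+ 2)%:E <= worst_risk K sigma eps muhat)%E.
Proof.
move=> d0 fd; have ds := feasible_le_sigma fd; case: fd => _ h.
have N0 : 0 < N%:R :> R by rewrite ltr0n.
have e0 : 0 < N%:R * delta ^+ 2 / sigma ^+ 2.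
  by rewrite divr_gt0 ?mulr_gt0 ?exprn_gt0.
have lp := le_elog e0 h.
have : ((expR (N%:R * delta ^+ 2 / sigma ^+ 2 / 2))%:E < local_packing K delta 2)%E.
  by apply: lt_le_trans lp; rewrite lte_fin ltr_expR; lra.
move=> /local_packing_gt[nu [s [Knu ps]]]; rewrite lte_fin => hs.
have half : 0 < (1 / 2 : R) <= 1 by lra.
have ps' := homothety_packing half sK ps.
have := worst_risk_fano (K := K) (sigma := sigma) (eps := eps) (tau := 1 / 2 * delta)
  (eta := 1 / 2 * (delta / 2)) muhat s0 (ltW eps0) _ _ ps'.
rewrite size_map => fano.
have -> : 3 / 40 ^+ 2 * delta ^+ 2 = 3 / 100 * (1 / 2 * (delta / 2)) ^+ 2 by field.
apply: fano; [lra|lra| | ].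
- have : 1 < (size s)%:R :> R.
    apply: le_lt_trans hs; rewrite -[leLHS]expR0 ler_expR; lra.
  by rewrite ltr1n.
- rewrite -expRM_natl; apply: le_trans (ltW hs); rewrite ler_expR.
  rewrite le_eqVlt; apply/orP; left; apply/eqP; field.
  by rewrite gt_eqF.
Qed.

(** The second hypothesis lies on the segment from [k] to [x], at the largest distance that
    [worst_risk_two_point] admits. *)
Lemma worst_risk_ge_contamination x (muhat : N.-tuple (n.-tuple R) -> n.-tuple R) :
  K x ->
  ((3 / 16 * Num.min (eps * sigma ^+ 2 / 4) (edist x k ^+ 2))%:E
    <= worst_risk K sigma eps muhat)%E.
Proof.
move=> Kx; pose rho := Num.min (Num.sqrt eps * sigma / 2) (edist x k).
have y0 : 0 <= Num.sqrt eps * sigma / 2.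
  by rewrite divr_ge0 // mulr_ge0 ?sqrtr_ge0 // ltW.
have r0 : 0 <= rho by rewrite /rho le_min y0 edist_ge0.
have [p Kp pk] : exists2 p, K p & edist p k = rho.
  by apply: star_segment Kx _ => //; rewrite r0 /rho ge_min lexx orbT.
have sq : (Num.sqrt eps * sigma / 2) ^+ 2 = eps * sigma ^+ 2 / 4.
  by rewrite !exprMn sqr_sqrtr ?ltW // exprVn; congr (_ / _); ring.
have e1 : eps <= 1 by apply: (le_trans (ltW eps32)); rewrite invf_le1 // ler1n.
have hle : 4 * edist p k ^+ 2 <= eps * sigma ^+ 2.
  rewrite pk; have : rho ^+ 2 <= (Num.sqrt eps * sigma / 2) ^+ 2.
    by rewrite lerXn2r ?nnegrE // /rho ge_min lexx.
  by rewrite sq; lra.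
have := worst_risk_two_point muhat N1 (proj1 sK) Kp eps0 e1 hle.
apply: le_trans; rewrite lee_fin ler_pM2l // pk /rho -sq.
by case: (leP (Num.sqrt eps * sigma / 2) (edist x k)) => h; rewrite ge_min lexx ?orbT.
Qed.

(** The packing scale is [2 ^ 18 * (2 * D + sqrt eps * sigma)]: [2 * D] makes the radius infeasible
    and so bounds its entropy, the other term outweighs the contamination, and the factor makes that
    entropy [2 ^ 36] times smaller than [N * x0]. *)
Lemma minimax_risk_le_rate D d x : 0 <= D ->
  (forall delta, feasible delta -> delta <= D) ->
  3 * D < d -> K x -> d / 3 <= edist x k ->
  (minimax_risk N K sigma eps <=
    (37 ^+ 2 * 2 ^+ 36 * Num.max (D * D) (eps * sigma ^+ 2))%:E)%E.
Proof.
move=> D0 feasD Dd Kx dx.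
have N0 : 0 < N%:R :> R by rewrite ltr0n.
have S20 : 0 < sigma ^+ 2 by rewrite exprn_gt0.
have e0 : 0 < edist x k by lra.
have ln2 : 1 / 2 <= ln 2 :> R.
  rewrite -ler_expR lnK ?posrE //.
  have := @expR_half_le R 1; rewrite lexx ler01 => /(_ isT); rewrite mul1r; lra.
have elog2 delta : 0 < delta <= edist x k -> ((ln 2)%:E <= elog (local_packing K delta 2))%E.
  move=> hd; have := local_packing_ge2 sK Kx hd.
  by case: (local_packing _ _ _) => [r| |] //=; rewrite ?leey ?leeNy_eq // !lee_fin => r2;
    rewrite ler_ln ?posrE //; lra.
pose M : R := 2 ^+ 34.
have M0 : 0 < M by rewrite exprn_gt0.
have M36 : 2 ^+ 36 = 4 * M by rewrite /M -[36%N]/(2 + 34)%N exprD; congr (_ * _); ring.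
have M32 : 4 * 2 ^+ 32 = M by rewrite /M -[34%N]/(2 + 32)%N exprD; congr (_ * _); ring.
have ML : (2 ^+ 18) ^+ 2 = 4 * M by rewrite -exprM -M36.
have L1 : 1 <= 2 ^+ 18 :> R by rewrite exprn_ege1 // ler1n.
have N2M : 2 * M <= N%:R.
  have ee : 0 < edist x k <= edist x k by rewrite e0 lexx.
  have := le_trans (elog2 _ ee) (elog_local_packing_le e0).
  rewrite lee_fin M36 ler_pdivlMr ?mulr_gt0 // => h.
  have : 1 / 2 * (4 * M) <= ln 2 * (4 * M) by rewrite ler_pM2r ?mulr_gt0.
  lra.
(* The entropy [ln 2] makes [min y (edist x k)] feasible, hence at most [D]; as [edist x k > D],
   this bounds [y]. *)
have D2 : sigma ^+ 2 / (2 * N%:R) <= D ^+ 2.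
  pose y := sigma * Num.sqrt (ln 2 / N%:R).
  have l0 : 0 < ln 2 / N%:R :> R by rewrite divr_gt0 //; lra.
  have y0 : 0 < y by rewrite mulr_gt0 // sqrtr_gt0.
  have y2 : y ^+ 2 = sigma ^+ 2 * (ln 2 / N%:R) by rewrite exprMn sqr_sqrtr // ltW.
  pose delta := Num.min y (edist x k).
  have dgt : 0 < delta by rewrite lt_min y0.
  have dD : delta <= D.
    apply: feasD; split; first exact: ltW.
    apply: le_trans (elog2 _ _); last by rewrite dgt ge_min lexx orbT.
    rewrite lee_fin ler_pdivrMr //; have : delta ^+ 2 <= y ^+ 2.
      by apply: lerXn2r; rewrite ?nnegrE; [exact: ltW|exact: ltW|rewrite /delta ge_min lexx].
    rewrite y2 => h; have := ler_wpM2l (ltW N0) h.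
    by rewrite (_ : N%:R * (sigma ^+ 2 * (ln 2 / N%:R)) = ln 2 * sigma ^+ 2) //; field; rewrite gt_eqF.
  have yD : y <= D.
    by move: dD; rewrite /delta ge_min => /orP[//|]; lra.
  apply: (@le_trans _ _ (y ^+ 2)); last by rewrite lerXn2r ?nnegrE // ltW.
  rewrite y2 ler_pM2l // invfM ler_pM2r ?invr_gt0 //; lra.
pose y := Num.sqrt eps * sigma.
have y0 : 0 <= y by rewrite mulr_ge0 ?sqrtr_ge0 // ltW.
have y2 : y ^+ 2 = eps * sigma ^+ 2 by rewrite exprMn sqr_sqrtr // ltW.
have Dgt : 0 < D.
  rewrite lt_def D0 andbT; apply/eqP => DE; move: D2; rewrite DE expr0n /= leNgt => /negP; apply.
  by rewrite divr_gt0 // mulr_gt0.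
pose delta1 := 2 * D + y.
have d1gt : 0 < delta1 by rewrite /delta1; lra.
pose delta := 2 ^+ 18 * delta1.
have dgt : 0 < delta by rewrite mulr_gt0 // exprn_gt0.
pose x0 := delta ^+ 2 / sigma ^+ 2.
have x00 : 0 < x0 by rewrite divr_gt0 // exprn_gt0.
have delta2 : delta ^+ 2 = 4 * M * delta1 ^+ 2 by rewrite exprMn ML.
have d12 : 4 * D ^+ 2 <= delta1 ^+ 2 by rewrite /delta1; nra.
have d1y : y ^+ 2 <= delta1 ^+ 2 by rewrite /delta1; nra.
(* For [x0 > 1] the bound is the assumption on [N]; for [x0 <= 1] it is the infeasibility of
   [delta1], carried to larger radii by monotonicity. *)
pose H := N%:R * Num.min x0 1 / (4 * M).
have m0 : 0 < Num.min x0 1 by rewrite lt_min x00 ltr01.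
have H0 : 0 <= H by rewrite divr_ge0 ?mulr_ge0 // ltW.
have hloc i : (local_packing K (2 ^+ i * delta) 2 <= (expR H)%:E)%E.
  have i1 : 1 <= 2 ^+ i :> R by rewrite exprn_ege1 // ler1n.
  have idgt : 0 < 2 ^+ i * delta by rewrite mulr_gt0 // exprn_gt0.
  rewrite /H; case: (leP x0 1) => hx; last first.
    by rewrite mulr1; apply: elog_le; rewrite -M36; exact: elog_local_packing_le.
  apply: (@le_trans _ _ (local_packing K delta1 2)).
    apply: (local_packing_antimono _ sK); rewrite d1gt /= /delta mulrA ler_peMl ?(ltW d1gt) //.
    by rewrite mulr_ege1.
  apply: elog_le; rewrite leNgt; apply/negP => hlt.
  have : delta1 <= D.
    apply: feasD; split; first exact: ltW.
    apply: le_trans (ltW hlt); rewrite lee_fin le_eqVlt; apply/orP; left; apply/eqP.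
    by rewrite /x0 delta2; field; rewrite !gt_eqF.
  by rewrite /delta1; lra.
(* The largest value that the test bound allows; since [N >= 2 * M], rounding loses at most a factor
   two. *)
pose r := Num.truncn (N%:R / M).
have NM0 : 0 <= N%:R / M by rewrite divr_ge0 // ltW.
have /andP[r1 r2] := truncn_itv NM0; rewrite -/r in r1 r2.
have NM2 : 2 <= N%:R / M by rewrite ler_pdivlMr.
have rN : N%:R / (2 * M) <= r%:R.
  rewrite (_ : N%:R / (2 * M) = N%:R / M / 2); last by field; rewrite gt_eqF.
  by move: r2; rewrite -natr1; lra.
apply: (le_trans (minimax_risk_tournament (eps := eps) (r := r) bK sK dgt s0 _ hloc H0 _ _ _ _)).
- exact: ltW.
- rewrite -/x0 /H.
  rewrite (_ : N%:R * Num.min x0 1 / (4 * M) = N%:R / (2 * M) * (Num.min x0 1 / 2)).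
    by rewrite -[leRHS]mulrA ler_pM2r // divr_gt0.
  by field; rewrite gt_eqF.
- rewrite -/x0; apply: (@le_trans _ _ (N%:R / (2 * M) * (16 * M / (2 * N%:R)))).
    by rewrite (_ : _ * _ = 4); [lra|field; rewrite !gt_eqF].
  apply: ler_pM => //; [by rewrite divr_ge0 // mulr_ge0 // ltW|by rewrite divr_ge0 // mulr_ge0 // ltW|].
  rewrite /x0 ler_pdivlMr // delta2.
  rewrite (_ : 16 * M / (2 * N%:R) * sigma ^+ 2 = 16 * M * (sigma ^+ 2 / (2 * N%:R))); last first.
    by field; rewrite gt_eqF.
  have : 16 * M * (sigma ^+ 2 / (2 * N%:R)) <= 16 * M * D ^+ 2 by rewrite ler_pM2l ?mulr_gt0.
  have : 4 * M * (4 * D ^+ 2) <= 4 * M * delta1 ^+ 2 by rewrite ler_pM2l ?mulr_gt0.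
  lra.
- by rewrite M36 delta2 -mulrA -y2 ler_pM2l ?mulr_gt0.
- by rewrite mulrAC M32 mulrC -ler_pdivlMr.
rewrite lee_fin M36 delta2.
set mx := Num.max _ _.
have mD : D ^+ 2 <= mx by rewrite /mx expr2 le_max lexx.
have my : y ^+ 2 <= mx by rewrite y2 /mx le_max lexx orbT.
(* [delta1 ^ 2 <= 8 * D ^ 2 + 2 * y ^ 2]; the final constant then uses [132 * 10 <= 37 ^ 2]. *)
have h10 : delta1 ^+ 2 <= 10 * mx by rewrite /delta1; have := sqr_ge0 (2 * D - y); nra.
have : 4 * M * delta1 ^+ 2 <= 4 * M * (10 * mx) by rewrite ler_pM2l ?mulr_gt0.
have : 0 <= M * mx.
  by apply: mulr_ge0; [exact: ltW|apply: le_trans mD; exact: sqr_ge0].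
lra.
Qed.

End Assembly.

Theorem mainTheorem1 (R : realType) :
  exists c A C1 C2 : R, 0 < c /\ 0 < A /\ 0 < C1 /\ 0 < C2 /\
  forall (n N : nat) (K : set (n.-tuple R)) (sigma eps : R),
    (1 <= n)%N -> (1 <= N)%N ->
    bounded_euclid K -> star_shaped K ->
    0 < sigma -> 0 < eps < 32^-1 ->
    (A%:E * sup_local_entropy K c <= (N%:R)%:E)%E ->
    (C1%:E * minimax_rate K N sigma eps c <= minimax_risk N K sigma eps)%E /\
    (minimax_risk N K sigma eps <= C2%:E * minimax_rate K N sigma eps c)%E.
Proof.
have p36 : 1 <= 2 ^+ 36 :> R by rewrite exprn_ege1 // ler1n.
pose C1 : R := (16^-1) ^+ 3.
have C1_gt0 : 0 < C1 by rewrite exprn_gt0 // invr_gt0.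
(* [3 / 80 ^ 2] is the entropy constant [3 / 40 ^ 2] at a feasible radius above [D / 2], as [D]
   itself may be infeasible; the contamination constants are larger. *)
have C1_le : C1 <= 3 / 80 ^+ 2 by rewrite /C1; lra.
exists 2, (2 ^+ 36), C1, (37 ^+ 2 * 2 ^+ 36).
split; first exact: ltr0Sn.
split; first exact: exprn_gt0.
split; first by [].
split; first by rewrite mulr_gt0 ?exprn_gt0.
clearbody C1.
move=> n N K sigma eps _ N1 bK [k [Kk starK]] s0 /andP[e0 e32] entropy.
have sK : star_center K k by [].
have [d [dE d0 dub [x Kx dx]]] := diameter_real bK Kk.
have [D [DE D0 feasD supD]] := delta_star_real sK N1 s0 entropy.
rewrite /minimax_rate DE dE -!EFinM -EFin_max -EFin_min -!EFinM.
set mx := Num.max _ _.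
have mx0 : 0 <= mx by rewrite /mx le_max mulr_ge0.
have DD : D * D = D ^+ 2 by rewrite expr2.
have dd : d * d = d ^+ 2 by rewrite expr2.
have upper_d : (minimax_risk N K sigma eps <= (d ^+ 2)%:E)%E.
  by apply: (@minimax_risk_le_sqr_radius _ _ _ _ _ _ k) => // z Kz; exact: dub.
split.
  apply: le_ereal_inf_tmp => _ [muhat _ <-].
  have lower_eps := worst_risk_ge_contamination sK N1 s0 e0 e32 muhat Kx.
  have [D_le|D_gt] := leP (eps * sigma ^+ 2) (D * D).
    have [DE0|Dn0] := eqVneq D 0.
      apply: le_trans lower_eps; rewrite lee_fin /mx max_l // DE0 mul0r.
      apply: (@le_trans _ _ 0).
        by rewrite mulr_ge0_le0 ?(ltW C1_gt0) // ge_min lexx.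
      rewrite mulr_ge0 // le_min sqr_ge0 andbT divr_ge0 // mulr_ge0 ?sqr_ge0 //; exact: ltW.
    have Dgt : 0 < D by rewrite lt_def Dn0.
    have [|delta fd Ddelta] := supD (D / 2); first by lra.
    have dgt : 0 < delta by lra.
    have := worst_risk_ge_feasible sK N1 s0 e0 entropy muhat dgt fd.
    apply: le_trans; rewrite lee_fin /mx max_l //.
    apply: (@le_trans _ _ (C1 * (D * D))).
      by rewrite ler_pM2l // ge_min lexx.
    have : (D / 2) ^+ 2 <= delta ^+ 2 by rewrite lerXn2r ?nnegrE //; lra.
    rewrite DD exprMn exprVn => hD.
    have := ler_wpM2r (sqr_ge0 D) C1_le; lra.
  apply: le_trans lower_eps; rewrite lee_fin /mx max_r ?(ltW D_gt) //.
  have : (d / 3) ^+ 2 <= edist x k ^+ 2 by rewrite lerXn2r ?nnegrE ?edist_ge0 //; lra.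
  rewrite exprMn exprVn dd.
  have es0 : 0 <= eps * sigma ^+ 2 by rewrite mulr_ge0 ?sqr_ge0 // ltW.
  have d20 : 0 <= d ^+ 2 by exact: sqr_ge0.
  move: (eps * sigma ^+ 2) (d ^+ 2) (edist x k ^+ 2) es0 d20 => a b c a0 b0 bc.
  apply: (@le_trans _ _ (3 / 80 ^+ 2 * Num.min a b)).
    by rewrite ler_wpM2r // le_min a0.
  by case: (leP a b); case: (leP (a / 4) c); lra.
(* When [d <= 3 * D], [d ^ 2] is at most [9] times the rate and the constant estimator suffices. *)
have [d_le|d_gt] := leP d (3 * D).
  apply: le_trans upper_d _; rewrite lee_fin.
  have h9 : d ^+ 2 <= 9 * mx.
    have : d ^+ 2 <= (3 * D) ^+ 2 by rewrite lerXn2r ?nnegrE //; lra.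
    have : D ^+ 2 <= mx by rewrite -DD /mx le_max lexx.
    by rewrite exprMn; lra.
  have d20 : 0 <= d ^+ 2 by exact: sqr_ge0.
  apply: (@le_trans _ _ (9 * Num.min mx (d * d))).
    by rewrite dd; case: (leP mx (d ^+ 2)) => _ //; lra.
  rewrite ler_wpM2r ?le_min ?mx0 ?mulr_ge0 //; lra.
have upper := minimax_risk_le_rate bK sK N1 s0 e0 e32 entropy D0 feasD d_gt Kx dx.
rewrite dd; case: (leP mx (d ^+ 2)) => _; first exact: upper.
apply: le_trans upper_d _; rewrite lee_fin.
by rewrite ler_peMl ?sqr_ge0 //; lra.
Qed.
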